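(* Let $1\le k\le n-1$, $f(y)=f_0(y_n)$ for $y\in\mathbb R^n_+$, and $f_1(s)=f_0(s)s^{(k-2)/2}$. Then for all $x\in\mathbb R^n_+$ and $\xi\in G_k(\mathbb R^{n-1})$, $$(Jf)(x,\xi)=\Phi(x_n),\qquad \Phi(x_n)=\frac{\Gamma((k+1)/2)}{\pi^{1/2}}\,x_n^{1-k}\,F(2x_n),$$ where $$F(t)=\frac{1}{\Gamma(k/2)}\int_0^t (t-s)^{(k-2)/2}f_1(s)\,ds.$$ It is assumed that the integral defining $F$ exists in the Lebesgue sense.
   Context: $\mathbb R^n_+=\{x=(x',x_n):x'\in\mathbb R^{n-1},x_n>0\}$, $e_n=(0,\dots,0,1)$; $G_k(\mathbb R^{n-1})$ is the Grassmannian of $k$-dimensional linear subspaces of $\mathbb R^{n-1}$ (identified with $\{x_n=0\}$). $\sigma_k=2\pi^{(k+1)/2}/\Gamma((k+1)/2)$ is the area of $\mathbb S^k$. For $x\in\mathbb R^n_+$, $\xi\in G_k(\mathbb R^{n-1})$, $$(Jf)(x,\xi)=\frac1{\sigma_k}\int_{\mathbb S^k_\xi}f(x+x_n\theta)\,d\theta,\qquad \mathbb S^k_\xi=\mathbb S^{n-1}\cap(\xi\oplus\mathbb R e_n),$$ with $d\theta$ the surface area measure: the mean of $f$ over the $k$-dimensional sphere centered at $x$, tangent to $\{x_n=0\}$ and lying in the vertical plane $x+(\xi\oplus\mathbb R e_n)$. *)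

(* Defs.v *)
From HB Require Import structures.
From mathcomp Require Import all_boot all_order all_algebra.
From mathcomp Require Import all_classical all_reals all_analysis.
From mathcomp Require Import measurable_realfun.

Set Implicit Arguments.
Unset Strict Implicit.
Unset Printing Implicit Defensive.
Import Order.TTheory GRing.Theory Num.Theory.
Import numFieldNormedType.Exports.

Local Open Scope classical_set_scope.
Local Open Scope ring_scope.

Section gamma.
Context {R : realType}.

Definition Gamma (a : R) : R :=
  \int[lebesgue_measure]_(t in `]0, +oo[) (t `^ (a - 1) * expR (- t)).

(* the area of the unit sphere of R^(k+1) *)
Definition sigma_ (k : nat) : R :=
  2 * pi `^ (k.+1%:R / 2) / Gamma (k.+1%:R / 2).

End gamma.

(* Lebesgue measure on R^d, as an iterated product on d-tuples. *)
Section lebesgue_tuple_step.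
Context {R : realType} (d : nat).
Variable mu : {sigma_finite_measure set (d.-tuple (measurableTypeR R)) -> \bar R}.

Let cons2 (p : measurableTypeR R * d.-tuple (measurableTypeR R)) :
  d.+1.-tuple (measurableTypeR R) := [tuple of p.1 :: p.2].

Let measurable_cons2 : measurable_fun setT cons2.
Proof. by apply: measurable_cons; [exact: measurable_fst|exact: measurable_snd]. Qed.

Definition lebesgue_tuple_step :
    set (d.+1.-tuple (measurableTypeR R)) -> \bar R :=
  pushforward (lebesgue_measure \x mu)%E cons2.

Let step0 : lebesgue_tuple_step set0 = 0%E.
Proof. by rewrite /lebesgue_tuple_step /pushforward preimage_set0 measure0. Qed.

Let step_ge0 A : (0 <= lebesgue_tuple_step A)%E.
Proof. exact: measure_ge0. Qed.

Let step_sigma_additive : semi_sigma_additive lebesgue_tuple_step.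
Proof.
move=> F mF tF mUF; rewrite /lebesgue_tuple_step /pushforward preimage_bigcup.
apply: measure_semi_sigma_additive.
- by move=> n; rewrite -[X in measurable X]setTI; exact: measurable_cons2.
- apply/trivIsetP => /= i j _ _ ij; rewrite -preimage_setI.
  by move/trivIsetP : tF => /(_ _ _ _ _ ij) ->//; rewrite preimage_set0.
- by rewrite -preimage_bigcup -[X in measurable X]setTI; exact: measurable_cons2.
Qed.

HB.instance Definition _ := isMeasure.Build _ _ _ lebesgue_tuple_step
  step0 step_ge0 step_sigma_additive.

Let step_sigma_finite : sigma_finite setT lebesgue_tuple_step.
Proof.
have [F TF mF] := sigma_finiteT (lebesgue_measure : {measure set (measurableTypeR R) -> \bar R}).
have [G TG mG] := sigma_finiteT mu.
pose uncons (t : d.+1.-tuple (measurableTypeR R)) :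
  measurableTypeR R * d.-tuple (measurableTypeR R) :=
  (thead t, [tuple of behead t]).
have munc : measurable_fun setT uncons.
  apply/measurable_fun_pairP; split; first exact: measurable_tnth.
  exact: measurable_behead.
have consK p : uncons (cons2 p) = p.
  case: p => a t; rewrite /uncons /cons2 /=; congr pair.
  exact: val_inj.
pose H (n : nat) : set (d.+1.-tuple (measurableTypeR R)) :=
  match (unpickle n : option (nat * nat)) with
  | Some ij => uncons @^-1` (F ij.1 `*` G ij.2)
  | None => set0 end.
exists H.
  apply/seteqP; split=> // t _.
  have : [set: measurableTypeR R] (thead t) by [].
  rewrite TF => -[i _ Fi].
  have : [set: d.-tuple (measurableTypeR R)] [tuple of behead t] by [].
  rewrite TG => -[j _ Gj].
  by exists (pickle (i, j)) => //; rewrite /H pickleK.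
move=> n; rewrite /H; case: (unpickle n) => [[i j]|]/=; last first.
  by split; [exact: measurable0|rewrite step0].
have [mFi Fioo] := mF i; have [mGj Gjoo] := mG j.
split.
  by rewrite -[X in measurable X]setTI; apply: munc => //; exact: measurableX.
rewrite /lebesgue_tuple_step /pushforward.
have -> : cons2 @^-1` (uncons @^-1` (F i `*` G j)) = F i `*` G j.
  by apply/funext => p; rewrite -[in RHS](consK p).
by rewrite product_measure1E// lte_mul_pinfty// ge0_fin_numE.
Qed.

HB.instance Definition _ := Measure_isSigmaFinite.Build _ _ _
  lebesgue_tuple_step step_sigma_finite.

End lebesgue_tuple_step.

Fixpoint lebesgue_tuple {R : realType} (d : nat) :
    {sigma_finite_measure set (d.-tuple (measurableTypeR R)) -> \bar R} :=
  match d with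
  | 0 => dirac [tuple]
  | d'.+1 => lebesgue_tuple_step (lebesgue_tuple d')
  end.

Section sphere.
Context {R : realType} (k : nat).
Local Notation T := (k.+1.-tuple (measurableTypeR R)).

Definition enorm (v : T) : R := Num.sqrt (\sum_i (tnth v i : R) ^+ 2).

Definition scalet (a : R) (v : T) : T := [tuple a * (tnth v i : R) | i < k.+1].

Definition sphere : set T := [set v | enorm v = 1].

Definition cone (A : set T) : set T :=
  [set v | 0 < enorm v <= 1 /\ A (scalet (enorm v)^-1 v)].

(* Surface area measure of S^k in R^(k+1), through the polar decomposition
   dv = r^k dr dtheta: the area of A is k + 1 times the volume of the cone
   { r theta : 0 < r <= 1, theta in A }. *)
Definition sphere_area (A : set T) : \bar R :=
  (k.+1%:R%:E * lebesgue_tuple k.+1 (cone A))%E.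

Let measurable_enorm : measurable_fun [set: T] enorm.
Proof.
apply: (@measurableT_comp _ _ _ _ _ _ (@Num.sqrt R)).
  by apply: continuous_measurable_fun; exact: sqrt_continuous.
by apply: measurable_sum => i; apply: measurable_funX; exact: measurable_tnth.
Qed.

Let proj (v : T) : T := scalet (enorm v)^-1 v.

Let measurable_proj : measurable_fun [set: T] proj.
Proof.
apply/measurable_fun_tnthP => i.
rewrite (_ : _ \o _ = (fun v : T => enorm v `^ (- 1) * (tnth v i : R))); last first.
  by apply/funext => v /=; rewrite tnth_mktuple powR_inv1// sqrtr_ge0.
apply: measurable_funM; last exact: measurable_tnth.
exact: (@measurableT_comp _ _ _ _ _ _ (@powR R ^~ (-1))).
Qed.

Let measurable_cone A : measurable A -> measurable (cone A).
Proof.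
move=> mA.
rewrite (_ : cone A = (enorm @^-1` `]0, 1]) `&` (proj @^-1` A)); last first.
  by apply/seteqP; split=> v; rewrite /cone /preimage /= in_itv.
by apply: measurableI; rewrite -[X in measurable X]setTI;
  [exact: measurable_enorm|exact: measurable_proj].
Qed.

Let area0 : sphere_area set0 = 0%E.
Proof.
rewrite /sphere_area (_ : cone set0 = set0) ?measure0 ?mule0//.
by apply/seteqP; split=> v // -[].
Qed.

Let area_ge0 A : (0 <= sphere_area A)%E.
Proof. by rewrite mule_ge0// lee_fin. Qed.

Let area_sigma_additive : semi_sigma_additive sphere_area.
Proof.
move=> F mF tF mUF; rewrite /sphere_area.
have coneU : cone (\bigcup_n F n) = \bigcup_n cone (F n).
  apply/seteqP; split=> v.
    by move=> [vB [i _ Fi]]; exists i.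
  by move=> [i _ [vB Fi]]; split=> //; exists i.
rewrite [X in X @ _ --> _](_ : _ = (fun n => k.+1%:R%:E *
    \sum_(0 <= i < n) lebesgue_tuple k.+1 (cone (F i)))%E); last first.
  by apply/funext => n; rewrite ge0_sume_distrr.
apply: cvgeZl => //; rewrite coneU.
apply: measure_semi_sigma_additive.
- by move=> n; exact: measurable_cone.
- apply/trivIsetP => /= i j _ _ ij; apply/seteqP; split=> v // -[[_ Fi] [_ Fj]].
  move/trivIsetP : tF => /(_ i j Logic.I Logic.I ij) FF.
  by have : (F i `&` F j) (scalet (enorm v)^-1 v) by []; rewrite FF.
- by rewrite -coneU; exact: measurable_cone.
Qed.

HB.instance Definition _ := isMeasure.Build _ _ _ sphere_area
  area0 area_ge0 area_sigma_additive.

Definition completed_sphere_area : set _ -> \bar R :=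
  @completed_measure_extension _ _ _ sphere_area.

HB.instance Definition _ := Measure.on completed_sphere_area.

End sphere.
Arguments sphere {R}.
Arguments sphere_area {R}.
Arguments completed_sphere_area {R}.

(* Orthonormal bases of a subspace, as the rows of a matrix. *)
Definition orthobasis {R : realType} (k m : nat) (xi : {vspace 'rV[R]_m})
    (u : 'M[R]_(k, m)) : Prop :=
  u *m u^T = 1%:M /\ <<[seq row i u | i <- enum 'I_k]>>%VS = xi.

Lemma orthobasis_exists {R : realType} (k m : nat) (xi : {vspace 'rV[R]_m}) :
  \dim xi = k -> exists u : 'M[R]_(k, m), orthobasis xi u.
Proof.
pose dot (a b : 'rV[R]_m) : R := (a *m b^T) 0 0.
have dotC a b : dot a b = dot b a.
  by rewrite /dot -[b *m _]trmxK trmx_mul trmxK [RHS]mxE.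
have dotDl a b c : dot (a + b) c = dot a c + dot b c.
  by rewrite /dot mulmxDl mxE.
have dotZl t a c : dot (t *: a) c = t * dot a c.
  by rewrite /dot -scalemxAl mxE.
have dotsum (I : Type) (r : seq I) (P : pred I) F c :
    dot (\sum_(i <- r | P i) F i) c = \sum_(i <- r | P i) dot (F i) c.
  by rewrite /dot mulmx_suml summxE.
have dotE a : dot a a = \sum_j a 0 j ^+ 2.
  by rewrite /dot mxE; apply: eq_bigr => j _; rewrite mxE expr2.
have dot_ge0 a : 0 <= dot a a by rewrite dotE sumr_ge0// => j _; rewrite sqr_ge0.
have dot_eq0 a : dot a a = 0 -> a = 0.
  move=> /eqP; rewrite dotE psumr_eq0; last by move=> j _; rewrite sqr_ge0.
  move=> /allP a0; apply/rowP => j; rewrite mxE; apply/eqP.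
  by have := a0 j (mem_index_enum _); rewrite /= sqrf_eq0.
pose on (Y : seq 'rV[R]_m) := forall i j, (i < size Y)%N -> (j < size Y)%N ->
  dot Y`_i Y`_j = (i == j)%:R.
have GS (X : seq 'rV[R]_m) : exists2 Y, on Y & <<Y>>%VS = <<X>>%VS.
  elim: X => [|x X [Y onY spanY]]; first by exists [::].
  pose p := \sum_(i < size Y) dot x Y`_i *: Y`_i.
  pose r := x - p.
  have pY : p \in <<Y>>%VS.
    by apply: memv_suml => i _; apply: memvZ; apply: memv_span; exact: mem_nth.
  have rY j : (j < size Y)%N -> dot r Y`_j = 0.
    move=> jY; rewrite /r dotDl -scaleN1r dotZl mulN1r dotsum.
    rewrite (bigD1 (Ordinal jY))//= dotZl onY// eqxx mulr1 big1 ?addr0 ?subrr//.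
    by move=> i ij; rewrite dotZl onY// (negbTE (ij : (i : nat) != j)) mulr0.
  have [r0|r0] := eqVneq r 0.
    exists Y => //; rewrite span_cons -spanY; apply/esym/addv_idPr.
    by rewrite -memvE (_ : x = p)//; apply/eqP; rewrite -subr_eq0 -/r r0.
  have dr : 0 < dot r r.
    by rewrite lt_def dot_ge0 andbT; apply: contra_neq r0; exact: dot_eq0.
  pose c := (Num.sqrt (dot r r))^-1.
  have c0 : c != 0 by rewrite invr_eq0 gt_eqF// sqrtr_gt0.
  exists (c *: r :: Y).
    move=> [|i] [|j] /=; rewrite ?ltnS => iY jY.
    - rewrite dotZl dotC dotZl mulrA -expr2 exprVn sqr_sqrtr//.
      by rewrite mulVf// gt_eqF.
    - by rewrite dotZl rY// mulr0.
    - by rewrite dotC dotZl rY// mulr0.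
    - by rewrite onY.
  rewrite !span_cons -spanY; apply/eqP; rewrite eqEsubv !subv_add !addvSr !andbT.
  rewrite -!memvE; apply/andP; split.
    apply: memvZ; rewrite /r memvB//.
      by rewrite memvE addvSl.
    by apply: (subvP (addvSr _ _)).
  have -> : x = c^-1 *: (c *: r) + p by rewrite scalerA mulVf// scale1r subrK.
  by apply: memv_add => //; rewrite memvZ// memv_line.
move=> dimxi; have [Y onY spanY] := GS (vbasis xi).
rewrite (span_basis (vbasisP xi)) in spanY.
have freeY : free Y.
  rewrite -(in_tupleE Y) ; apply/freeP => c /= c0 i.
  have := congr1 (dot ^~ Y`_i) c0; rewrite dotsum (bigD1 i)//= dotZl onY//.
  rewrite eqxx mulr1 big1 ?addr0 => [->|j ji].
    by rewrite /dot mul0mx mxE.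
  by rewrite dotZl onY// (negbTE (ji : (j : nat) != i)) mulr0.
have sizeY : size Y = k by rewrite -dimxi -spanY; apply/esym/eqP.
exists (\matrix_(i < k) Y`_i); split.
  apply/matrixP => i j; rewrite [LHS]mxE [RHS]mxE -(onY i j) ?sizeY//.
  by rewrite /dot mxE; apply: eq_bigr => l _; rewrite !mxE.
rewrite -spanY; congr (<<_>>%VS); apply: (@eq_from_nth _ 0).
  by rewrite size_map size_enum_ord sizeY.
rewrite size_map size_enum_ord => i ik.
rewrite (nth_map (Ordinal ik)) ?size_enum_ord// rowK; congr (_`_ _).
by rewrite -[X in nth _ _ X]/(val (Ordinal ik)) nth_ord_enum.
Qed.

Section transform.
Context {R : realType} (m k : nat).
Implicit Types (x : 'rV[R]_(m + 1)) (xi : {vspace 'rV[R]_m}).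

(* R^n = R^m * R with m = n - 1, and x_n is the last coordinate. *)
Definition last_coord x : R := rsubmx x 0 0.

Definition halfspace : set 'rV[R]_(m + 1) := [set x | 0 < last_coord x].

(* Some orthonormal basis of xi; the measure dtheta below does not depend on
   the choice, by rotation invariance of Lebesgue measure. *)
Definition frame xi : 'M[R]_(k, m) := xget 0 [set u | orthobasis xi u].

(* For dim xi = k, the linear isometry of R^(k+1) onto xi + R e_n given by
   (t, a_1, .., a_k) |-> sum_i a_i u_i + t e_n; it maps S^k onto S^k_xi and
   transports the surface area measure of the former to that of the latter. *)
Definition vertical xi (v : k.+1.-tuple R) : 'rV[R]_(m + 1) :=
  row_mx (\sum_(i < k) tnth v (lift ord0 i) *: row i (frame xi))
         (const_mx (thead v)).

(* All integrals are Lebesgue integrals for completed measures, so that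
   Lebesgue (and not only Borel) measurable functions are allowed. *)
Definition J_integrand (f : 'rV[R]_(m + 1) -> R) x xi
    (theta : k.+1.-tuple R) : R :=
  f (x + last_coord x *: vertical xi theta).

Definition J (f : 'rV[R]_(m + 1) -> R) x xi : R :=
  (sigma_ k)^-1 *
  \int[completed_sphere_area k]_(theta in sphere k)
     J_integrand f x xi theta.

End transform.
Arguments J {R m}.
Arguments J_integrand {R m}.

Section abel.
Context {R : realType} (k : nat) (f0 : R -> R).

Definition f1 (s : R) : R := f0 s * s `^ ((k%:R - 2) / 2).

Definition F_integrand (t s : R) : R := (t - s) `^ ((k%:R - 2) / 2) * f1 s.

Definition F (t : R) : R :=
  (Gamma (k%:R / 2))^-1 *
  \int[completed_lebesgue_measure]_(s in `]0, t[) F_integrand t s.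

Definition Phi (r : R) : R :=
  Gamma (k.+1%:R / 2) / pi `^ (1 / 2) * r `^ (1 - k%:R) * F (2 * r).

End abel.

(* Main.v *)
Require Import Defs.
From HB Require Import structures.
From mathcomp Require Import all_boot all_order all_algebra.
From mathcomp Require Import all_classical all_reals all_analysis.
From mathcomp Require Import measurable_realfun.
From mathcomp Require Import ring lra.

(* Only the height [x_n (1 + theta_n)] of the point [x + x_n theta] matters, so
   everything reduces to the image of the surface measure of S^k under
   [theta |-> theta_n = u], whose density is [k kappa (1 - u^2)^((k - 2) / 2)]
   on ]-1, 1[, with [kappa] the volume of the unit ball of R^k. Writing a point
   of R^(k+1) as (t, w) with |w| = r, the density is obtained on cones by Fubini
   from the substitution [t = r u / sqrt (1 - u^2)] at fixed w, followed by the
   radial integral of |w|. Evaluating the Gaussian integral of e^(-|w|^2) in two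
   ways gives [kappa (k / 2) Gamma (k / 2) = pi^(k / 2)]. Finally
   [s = x_n (1 + u)] turns [1 - u^2] into [s (2 x_n - s) / x_n^2]. Completed
   measures are handled by modifying [f0] on a Borel null set of heights. *)

Import Order.TTheory GRing.Theory Num.Theory.
Import numFieldNormedType.Exports.
Set Implicit Arguments.
Unset Strict Implicit.
Unset Printing Implicit Defensive.
Local Open Scope classical_set_scope.
Local Open Scope ring_scope.

(** [sphere_area] is only known through volumes of cones, so the density is read off such volumes;
    the factor k + 1 in its definition is cancelled by the 1 / (k + 1) of the radial integral.
    Substituting at fixed w keeps the change of variables one-dimensional: it is checked on
    half-open intervals by the fundamental theorem of calculus and extended to Borel sets by
    uniqueness of Lebesgue measure. Heights outside ]-1, 1[ escape the substitution; their cone lies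
    on the axis w = 0, which is null because k >= 1.

    The volume and Gamma identities are proved in the extended reals, where they need no finiteness;
    their finite nonzero product then forces both factors to be finite and positive.

    [f] carries no measurability assumption, and a Lebesgue measurable function composed with the
    height is not measurable for free. The remedy is that null sets of heights have null preimages
    on the sphere, by the density formula applied to an indicator; completeness of the surface
    measure then makes the original integrand measurable. *)

Lemma eq_indic (R : realType) (T U : Type) (A : set T) (B : set U) (x : T) (y : U) :
  (A x <-> B y) -> \1_A x = \1_B y :> R.
Proof.
move=> AB; rewrite !indicE; congr ((nat_of_bool _)%:R).
by apply/idP/idP; rewrite !inE => /AB.
Qed.

(** * Integrals of elementary functions *)

Lemma integral_mul_indic d (T : measurableType d) (R : realType)
    (mu : {measure set T -> \bar R}) (D : set T) (f : T -> R) :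
  (\int[mu]_(x in D) (f x)%:E = \int[mu]_x (f x * \1_D x)%:E)%E.
Proof.
rewrite integral_mkcond; apply: eq_integral => x _.
by rewrite patchE indicE; case: (x \in D); rewrite ?mulr1 ?mulr0.
Qed.

Lemma integral_is_derive (R : realType) (f F : R -> R) (a b : R) : a < b ->
  (forall x : R, a <= x <= b -> is_derive x 1 F (f x)) ->
  (forall x : R, a <= x <= b -> {for x, continuous f}) ->
  (\int[lebesgue_measure]_(x in `]a, b]) (f x)%:E = (F b)%:E - (F a)%:E)%E.
Proof.
move=> ab dF cf.
have cF x : a <= x <= b -> {for x, continuous F}.
  by move=> /dF dFx; apply: differentiable_continuous; apply/derivable1_diffP.
rewrite integral_itv_obnd_cbnd; last first.
  apply/measurable_EFinP; apply: (@measurable_fun_itv_oc _ a b false true).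
  apply: open_continuous_measurable_fun => //.
  by move=> x; rewrite inE/= in_itv/= => /andP[ax xb]; apply: cf; rewrite !ltW.
apply: continuous_FTC2 => //.
- apply/continuous_within_itvP => //; split.
  + by move=> x; rewrite in_itv/= => /andP[ax xb]; apply: cf; rewrite !ltW.
  + by apply: cvg_at_right_filter; apply: cf; rewrite lexx ltW.
  + by apply: cvg_at_left_filter; apply: cf; rewrite lexx ltW.
- split.
  + by move=> x; rewrite in_itv/= => /andP[ax xb]; have [] := dF x _; rewrite ?ltW.
  + by apply: cvg_at_right_filter; apply: cF; rewrite lexx ltW.
  + by apply: cvg_at_left_filter; apply: cF; rewrite lexx ltW.
- move=> x; rewrite in_itv/= => /andP[ax xb]; rewrite derive1E.
  by have [_ ->] : is_derive x 1 F (f x) by apply: dF; rewrite !ltW.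
Qed.

Lemma continuous_powR (R : realType) (p x : R) : 0 < x ->
  {for x, continuous (fun y : R => y `^ p)}.
Proof.
move=> x0; apply: differentiable_continuous; apply/derivable1_diffP.
by have [] := is_derive1_powR p x0.
Qed.

(** For [a < 1] the integrand is unbounded at 0, so the fundamental theorem of calculus is applied
    on intervals []b / (n + 2), b]] and monotone convergence does the rest. *)
Lemma integral_powR (R : realType) (a b : R) : 0 < a -> 0 <= b ->
  (\int[lebesgue_measure]_(s in `]0%R, b]) (a * s `^ (a - 1))%:E =
   (b `^ a)%:E)%E.
Proof.
move=> a0; rewrite le_eqVlt => /predU1P[<-|b0].
  by rewrite set_itvoc0 integral_set0 powR0// gt_eqF.
(* With [n + 2] the left end is strictly below [b] already at [n = 0]. *)
pose F (n : nat) : set R := [set` `](b / n.+2%:R), b]%R].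
have Fn n : 0 < b / n.+2%:R < b.
  by rewrite divr_gt0//= ltr_pdivrMr// ltr_pMr// ltr1n.
have FU : \bigcup_n F n = `]0, b]%classic.
  apply/seteqP; split=> [s [n _]|s] /=; rewrite /F/= !in_itv/=.
    by move=> /andP[+ ->]; have /andP[h _] := Fn n; move=> /(lt_trans h) ->.
  move=> /andP[s0 sb]; exists (Num.truncn (b / s)) => //=.
  rewrite in_itv/= sb andbT ltr_pdivrMr// -ltr_pdivrMl// mulrC.
  apply: (lt_trans (truncnS_gt _)); by rewrite ltr_nat.
have mf D : measurable D ->
    measurable_fun D (fun s : R => (a * s `^ (a - 1))%:E).
  move=> mD; apply/measurable_EFinP; apply: measurable_funM => //.
  by apply: measurable_funTS; exact: measurable_powR.
have /cvg_lim : (\int[lebesgue_measure]_(s in F i) (a * s `^ (a - 1))%:E)%E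
    @[i --> \oo] -->
  (\int[lebesgue_measure]_(s in `]0%R, b]) (a * s `^ (a - 1))%:E)%E.
  rewrite -FU; apply: ge0_nondecreasing_set_cvg_integral => //.
  - move=> m n mn; apply/subsetPset => s; rewrite /F/= !in_itv/= => /andP[h ->].
    rewrite andbT; apply: le_lt_trans h.
    by rewrite ler_pM2l// lef_pV2 ?posrE// ler_nat !ltnS.
  - by move=> i; exact: measurable_itv.
  - by move=> i; apply: mf; exact: measurable_itv.
  - by move=> i s _; rewrite lee_fin mulr_ge0 ?powR_ge0// ltW.
move=> <-//; apply/cvg_lim => //.
rewrite [X in X @ _ --> _](_ : _ =
    EFin \o (fun n => b `^ a - (b / n.+2%:R) `^ a)); last first.
  apply/funext => n /=; have /andP[h1 h2] := Fn n.
  rewrite EFinB.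
  apply: (@integral_is_derive _ (fun s => a * s `^ (a - 1)) (fun s => s `^ a)) => //.
    by move=> x /andP[h3 _]; apply: is_derive1_powR; exact: lt_le_trans h3.
  move=> x /andP[h3 _]; apply: continuousM; first exact: cst_continuous.
  by apply: continuous_powR; exact: lt_le_trans h3.
apply: cvg_EFin; first by near=> n.
rewrite -[X in _ --> X](subr0 (b `^ a)); apply: cvgB; first exact: cvg_cst.
have := @powR_cvg0 R a a0; move/cvg_at_rightP; apply; split => //.
  by move=> n; have /andP[] := Fn n.
rewrite -(mulr0 b); apply: cvgM; first exact: cvg_cst.
by have := @cvg_harmonic R; rewrite -cvg_shiftS.
Unshelve. all: by end_near. Qed.

Lemma integral_expRN (R : realType) (a : R) :
  (\int[lebesgue_measure]_(s in `[a, +oo[) (expR (- s))%:E = (expR (- a))%:E)%E.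
Proof.
have cE : continuous (fun x : R => expR (- x)).
  move=> x; apply: continuous_comp; first exact: opp_continuous.
  exact: continuous_expR.
have dE (x : R) : is_derive x 1 (fun x : R => - expR (- x)) (expR (- x)).
  rewrite -[expR (- x) in X in is_derive _ _ _ X]opprK; apply: is_deriveN.
  rewrite -mulrN1; apply: (@is_derive1_comp _ expR -%R x (expR (- x)) (-1)).
rewrite (@ge0_continuous_FTC2y _ _ (fun x => - expR (- x)) a 0).
- by rewrite sub0e EFinN oppeK.
- by move=> x _; exact: expR_ge0.
- exact: continuous_subspaceT.
- by rewrite -oppr0; apply: cvgN; exact: cvgr_expR.
- by move=> x _; have [] := dE x.
- by apply: cvg_at_right_filter; apply: cvgN; exact: cE.
- by move=> x _; rewrite derive1E; have [_ ->] := dE x.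
Qed.

(** * Changes of variables and transfer of integrals between measure spaces *)

Section lebesgue_density.
Local Open Scope ereal_scope.
Context (R : realType) (phi : R -> R) (w : R -> R).
Hypotheses (mphi : measurable_fun setT phi) (mw : measurable_fun setT w).
Hypothesis (w0 : forall x, (0 <= w x)%R).

(** The image under [phi] of the measure with density [w]. Once it is known to be a measure,
    agreement with Lebesgue measure need only be tested on half-open intervals. *)
Let nu (A : set (measurableTypeR R)) : \bar R :=
  \int[lebesgue_measure]_x ((w x)%:E * (\1_A (phi x))%:E).

Let mnu A : measurable A ->
  measurable_fun setT (fun x => (w x)%:E * (\1_A (phi x))%:E).
Proof.
move=> mA; apply: emeasurable_funM; apply/measurable_EFinP => //.
by apply: measurableT_comp => //; exact: measurable_indic.
Qed.

Let nu0 : nu set0 = 0.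
Proof.
rewrite /nu (eq_integral (cst 0)) ?integral0// => x _.
by rewrite indic0 mule0.
Qed.

Let nu_ge0 A : 0 <= nu A.
Proof. by apply: integral_ge0 => x _; rewrite mule_ge0 ?lee_fin. Qed.

Let nu_sigma_additive : semi_sigma_additive nu.
Proof.
move=> F mF tF mUF.
have -> : nu (\bigcup_n F n) = \sum_(n <oo) nu (F n).
  rewrite /nu -integral_nneseries//.
  - apply: eq_integral => x _; rewrite nneseriesZl//.
    (* Pointwise in [x], additivity over the [F n] is that of the Dirac measure at [phi x]. *)
    transitivity ((w x)%:E * \d_(phi x) (\bigcup_n F n)) => //.
    rewrite (@measure_semi_bigcup _ _ _ (@dirac _ (measurableTypeR R) (phi x) R)
      F mF tF mUF)//.
  - move=> n; exact: (mnu (mF n)).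
  - by move=> n x _; rewrite mule_ge0 ?lee_fin.
apply: is_cvg_nneseries => n _ _; exact: nu_ge0.
Qed.

HB.instance Definition _ := isMeasure.Build _ _ _ nu
  nu0 nu_ge0 nu_sigma_additive.

(* Change of variables [t = phi x] with jacobian [w]. *)
Lemma lebesgue_density_unique :
  (forall x y : R, (x < y)%R ->
    \int[lebesgue_measure]_t ((w t)%:E * (\1_`]x, y] (phi t))%:E) = (y - x)%:E) ->
  forall A, measurable A -> lebesgue_measure A =
    \int[lebesgue_measure]_x ((w x)%:E * (\1_A (phi x))%:E).
Proof.
move=> H; apply: (@lebesgue_measure_unique _ nu) => _ [[x y]] _ <-.
rewrite lebesgue_measure_itv/= lte_fin; case: ifPn => xy; first by rewrite -EFinB -H.
rewrite set_itv_ge ?bnd_simp ?measure0//. 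
Qed.

End lebesgue_density.

Section weighted_pushforward.
Local Open Scope ereal_scope.
Context d d' (X : measurableType d) (Y : measurableType d') (R : realType).
Variables (mu : {measure set X -> \bar R}) (phi : X -> Y) (w : X -> R).
Hypotheses (mphi : measurable_fun setT phi) (mw : measurable_fun setT w).
Hypothesis (w0 : forall x, (0 <= w x)%R).

Import HBNNSimple.

Lemma integral_weight_nnsfun (h : {nnsfun Y >-> R}) :
  \int[mu]_x ((w x)%:E * (h (phi x))%:E) =
  \sum_(k \in range h)
    (k%:E * \int[mu]_x ((w x)%:E * (\1_(h @^-1` [set k]) (phi x))%:E)).
Proof.
transitivity (\sum_(k \in range h)
    \int[mu]_x ((w x)%:E * (k * \1_(h @^-1` [set k]) (phi x))%:E)).
  rewrite -ge0_integral_fsum//.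
  - apply: eq_integral => x _; rewrite -ge0_mule_fsumr.
      by rewrite fsumEFin// -fimfunE.
    by move=> r; rewrite nnfun_muleindic_ge0.
  - move=> r; apply: emeasurable_funM; apply/measurable_EFinP => //.
    apply: measurable_funM => //.
    by apply: measurableT_comp => //; exact: measurable_indic.
  - move=> r x _; rewrite mule_ge0 ?(lee_fin _ (w _))// EFinM.
    exact: nnfun_muleindic_ge0.
apply: eq_fsbigr => r _.
have [r0|r0] := leP 0%R r; last first.
  rewrite preimage_nnfun0// (eq_integral (cst 0)); last first.
    by move=> x _; rewrite indic0 mulr0 mule0.
  rewrite integral0 (eq_integral (cst 0)) ?integral0 ?mule0// => x _.
  by rewrite indic0 mule0.
rewrite -ge0_integralZl//.
- by apply: eq_integral => x _; rewrite EFinM muleCA.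
- apply: emeasurable_funM; apply/measurable_EFinP => //.
  by apply: measurableT_comp => //; exact: measurable_indic.
- by move=> x _; rewrite mule_ge0 ?lee_fin.
Qed.

Lemma cvg_integral_weight (g : Y -> \bar R) (mg : measurable_fun setT g) :
  (forall y, 0 <= g y) ->
  \int[mu]_x ((w x)%:E * (nnsfun_approx measurableT mg n (phi x))%:E)
    @[n --> \oo] --> \int[mu]_x ((w x)%:E * g (phi x)).
Proof.
move=> g0; pose f_ := nnsfun_approx measurableT mg.
rewrite [X in _ --> X](_ : _ = \int[mu]_x
    limn (fun n => (w x)%:E * (f_ n (phi x))%:E)).
  apply: cvg_monotone_convergence => //.
  - move=> n; apply: emeasurable_funM; apply/measurable_EFinP => //.
    by apply: measurableT_comp => //; exact: measurable_funP.
  - by move=> n x _; rewrite mule_ge0 ?lee_fin.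
  - move=> x _ a b ab; apply: lee_pmul => //; rewrite ?lee_fin//.
    exact/lefP/nd_nnsfun_approx.
apply: eq_integral => x _; apply/esym/cvg_lim => //.
apply: cvgeZl => //.
exact: cvg_nnsfun_approx.
Qed.

End weighted_pushforward.

Section integral_transfer.
Import HBNNSimple.

(** An identity on indicators passes to simple functions by linearity, then to nonnegative functions
    by monotone convergence. Weights on both sides let it serve both for affine substitutions
    (weights 1 and [c]) and for the passage from the sphere to the line (weights: the indicator of
    the sphere and the density of the height). *)
Lemma ge0_integral_transfer d d1 d2 (Y : measurableType d)
    (X1 : measurableType d1) (X2 : measurableType d2) (R : realType)
    (mu1 : {measure set X1 -> \bar R}) (mu2 : {measure set X2 -> \bar R})
    (phi1 : X1 -> Y) (phi2 : X2 -> Y) (w1 : X1 -> R) (w2 : X2 -> R) :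
  measurable_fun setT phi1 -> measurable_fun setT w1 -> (forall x, 0 <= w1 x) ->
  measurable_fun setT phi2 -> measurable_fun setT w2 -> (forall x, 0 <= w2 x) ->
  (forall A, measurable A ->
    \int[mu1]_x ((w1 x)%:E * (\1_A (phi1 x))%:E) =
    \int[mu2]_x ((w2 x)%:E * (\1_A (phi2 x))%:E))%E ->
  forall g : Y -> \bar R, measurable_fun setT g -> (forall y, 0 <= g y)%E ->
  (\int[mu1]_x ((w1 x)%:E * g (phi1 x)) = \int[mu2]_x ((w2 x)%:E * g (phi2 x)))%E.
Proof.
move=> mphi1 mw1 w10 mphi2 mw2 w20 E g mg g0.
have /cvg_lim <-// := cvg_integral_weight (mu := mu1) mphi1 mw1 w10 mg g0.
have /cvg_lim <-// := cvg_integral_weight (mu := mu2) mphi2 mw2 w20 mg g0.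
congr (limn _); apply/funext => n.
rewrite !integral_weight_nnsfun//; apply: eq_fsbigr => k _.
by rewrite E//.
Qed.

End integral_transfer.


(** * Lebesgue measure on tuples *)

Lemma ge0_integral_affine (R : realType) (c b : R) (g : R -> \bar R) : 0 < c ->
  measurable_fun setT g -> (forall t, 0 <= g t)%E ->
  (\int[lebesgue_measure]_t g (c * t + b)%R =
   c^-1%:E * \int[lebesgue_measure]_t g t)%E.
Proof.
move=> c0 mg g0.
have mh : measurable_fun setT (fun t : R => c * t + b).
  by apply: measurable_funD => //; exact: measurable_funM.
have mgh : measurable_fun setT (fun t => g (c * t + b)).
  exact: measurableT_comp.
have c0' : (0 <= c%:E)%E by rewrite lee_fin ltW.
suff H : forall A, measurable A -> lebesgue_measure A =
    (\int[lebesgue_measure]_t (c%:E * (\1_A (c * t + b)%R)%:E))%E.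
  have -> : (\int[lebesgue_measure]_t g t =
      \int[lebesgue_measure]_t (c%:E * g (c * t + b)%R))%E.
    transitivity (\int[lebesgue_measure]_t (1%:E * g t))%E.
      by apply: eq_integral => t _; rewrite mul1e.
    apply: (@ge0_integral_transfer _ _ _ _ _ _ R lebesgue_measure
      lebesgue_measure id (fun t => c * t + b) (cst 1) (cst c)) => //.
    move=> A mA; rewrite -H//.
    transitivity (\int[@lebesgue_measure R]_t (\1_A t)%:E)%E.
      by apply: eq_integral => t _; rewrite mul1e.
    by rewrite integral_indic// setIT.
  by rewrite ge0_integralZl// muleA -EFinM (mulVf (lt0r_neq0 c0)) mul1e.
apply: lebesgue_density_unique => //.
move=> x y xy; rewrite ge0_integralZl//; last first.
  apply/measurable_EFinP; apply: (measurableT_comp _ mh).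
  exact: measurable_indic.
transitivity (c%:E * \int[lebesgue_measure]_t
    (\1_`](x - b) / c, (y - b) / c] t)%:E)%E.
  congr (_ * _)%E; apply: eq_integral => t _.
  congr EFin; apply: eq_indic.
  by rewrite /= !in_itv/= ltr_pdivrMr// ler_pdivlMr// ltrBlDr lerBrDr (mulrC t).
transitivity (c%:E * lebesgue_measure [set` `](x - b) / c, (y - b) / c]%R])%E.
  by rewrite integral_indic// setIT.
rewrite lebesgue_measure_itv/= lte_fin.
rewrite ltr_pM2r ?invr_gt0// ltrD2r xy -!EFinD -EFinM -mulrBl opprB addrA subrK.
by rewrite mulrCA divff ?mulr1// gt_eqF.
Qed.

Definition consT (R : realType) (d : nat) (t : R)
  (w : d.-tuple (measurableTypeR R)) : d.+1.-tuple (measurableTypeR R) :=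
  [tuple of t :: w].

(** Available in every dimension, including 0 where inductions start; [enorm], defined for nonempty
    tuples only, is its square root. *)
Definition nsq (R : realType) (d : nat) (v : d.-tuple (measurableTypeR R)) : R :=
  \sum_i (tnth v i : R) ^+ 2.

Lemma nsq_ge0 (R : realType) d (v : d.-tuple (measurableTypeR R)) : 0 <= nsq v.
Proof. by apply: sumr_ge0 => i _; exact: sqr_ge0. Qed.

Lemma nsq_cons (R : realType) d (t : R) (w : d.-tuple (measurableTypeR R)) :
  nsq (consT t w) = t ^+ 2 + nsq w.
Proof.
rewrite /nsq big_ord_recl/= tnth0; congr (_ + _).
by apply: eq_bigr => i _; rewrite tnthS.
Qed.

Lemma measurable_nsq (R : realType) d :
  measurable_fun [set: d.-tuple (measurableTypeR R)] (@nsq R d).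
Proof.
by apply: measurable_sum => i; apply: measurable_funX; exact: measurable_tnth.
Qed.

Definition dilate (R : realType) (d : nat) (c : R)
    (v : d.-tuple (measurableTypeR R)) : d.-tuple (measurableTypeR R) :=
  [tuple c * (tnth v i : R) | i < d].

Lemma nsq_dilate (R : realType) d (c : R) (v : d.-tuple (measurableTypeR R)) :
  nsq (dilate c v) = c ^+ 2 * nsq v.
Proof.
rewrite /nsq mulr_sumr; apply: eq_bigr => i _.
by rewrite tnth_mktuple exprMn.
Qed.

Lemma dilate_cons (R : realType) d (c t : R) (w : d.-tuple (measurableTypeR R)) :
  dilate c (consT t w) = consT (c * t) (dilate c w).
Proof.
apply: eq_from_tnth => i; rewrite tnth_mktuple.
case: (unliftP ord0 i) => [j ->|->]; last by rewrite !tnth0.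
by rewrite !tnthS tnth_mktuple.
Qed.

Lemma measurable_dilate (R : realType) d (c : R) :
  measurable_fun setT (@dilate R d c).
Proof.
apply/measurable_fun_tnthP => i.
rewrite (_ : _ \o _ = (fun v : d.-tuple (measurableTypeR R) =>
    c * (tnth v i : R))); last first.
  by apply/funext => v /=; rewrite tnth_mktuple.
by apply: measurable_funM => //; exact: measurable_tnth.
Qed.

Section tuple_integral.
Local Open Scope ereal_scope.
Context (R : realType) (d : nat).
Notation L := (lebesgue_tuple d).

Lemma measurable_consT : measurable_fun
  [set: measurableTypeR R * d.-tuple (measurableTypeR R)]
  (fun p => consT p.1 p.2).
Proof. by apply: measurable_cons; [exact: measurable_fst|exact: measurable_snd]. Qed.

Lemma integral_lebesgue_tupleS (g : d.+1.-tuple (measurableTypeR R) -> \bar R) :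
  measurable_fun setT g -> (forall v, 0 <= g v) ->
  \int[lebesgue_tuple d.+1]_v g v =
  \int[lebesgue_measure]_t \int[L]_w g (consT t w).
Proof.
move=> mg g0.
have mgc : measurable_fun setT (g \o (fun p => consT p.1 p.2)).
  by apply: measurableT_comp => //; exact: measurable_consT.
transitivity (\int[lebesgue_measure \x L]_p g (consT p.1 p.2)).
  by rewrite (ge0_integral_pushforward measurable_consT).
exact: (@fubini_tonelli1 _ _ _ _ _ lebesgue_measure L (fun p => g (consT p.1 p.2))).
Qed.

Lemma integral_lebesgue_tupleS_swap
    (g : d.+1.-tuple (measurableTypeR R) -> \bar R) :
  measurable_fun setT g -> (forall v, 0 <= g v) ->
  \int[lebesgue_tuple d.+1]_v g v =
  \int[L]_w \int[lebesgue_measure]_t g (consT t w).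
Proof.
move=> mg g0.
have mgc : measurable_fun setT (g \o (fun p => consT p.1 p.2)).
  by apply: measurableT_comp => //; exact: measurable_consT.
rewrite integral_lebesgue_tupleS//.
exact: (@fubini_tonelli _ _ _ _ _ lebesgue_measure L
  (fun p => g (consT p.1 p.2))).
Qed.

End tuple_integral.

Lemma ge0_integral_dilate (R : realType) (d : nat) (c : R)
    (g : d.-tuple (measurableTypeR R) -> \bar R) : 0 < c ->
  measurable_fun setT g -> (forall v, 0 <= g v)%E ->
  (\int[lebesgue_tuple d]_v g (dilate c v) =
   (c ^- d)%:E * \int[lebesgue_tuple d]_v g v)%E.
Proof.
move=> c0; elim: d g => [|d IH] g mg g0.
  rewrite /= !integral_dirac//; last first.
    by apply: measurableT_comp => //; exact: measurable_dilate.
  rewrite expr0 invr1 mul1e; congr (_ * g _)%E.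
  exact: tuple0.
rewrite !integral_lebesgue_tupleS//; last first.
  by apply: measurableT_comp => //; exact: measurable_dilate.
have mgc : measurable_fun setT (g \o (fun p => consT p.1 p.2)).
  by apply: measurableT_comp => //; exact: measurable_consT.
have mgt t : measurable_fun setT (fun w => g (consT t w)).
  by apply: (measurableT_comp mgc (measurable_pair1 t)).
have mG : measurable_fun setT
    (fun t => \int[lebesgue_tuple d]_w g (consT t w))%E.
  have := @measurable_fun_fubini_tonelli_F _ _ _ _ _ (lebesgue_tuple d) _ mgc.
  by apply => p; exact: g0.
(* The induction hypothesis handles the tail; the term [+ 0] gives the first coordinate the shape
   expected by [ge0_integral_affine], which yields the last factor [c^-1]. *)
transitivity (\int[lebesgue_measure]_t ((c ^- d)%:E *
    \int[lebesgue_tuple d]_w g (consT (c * t + 0)%R w)))%E.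
  apply: eq_integral => t _; rewrite -IH//.
  by apply: eq_integral => w _; rewrite dilate_cons addr0.
have cd0 : (0 <= (c ^- d)%:E)%E by rewrite lee_fin invr_ge0 exprn_ge0// ltW.
rewrite ge0_integralZl; [|exact: measurableT| | |exact: cd0].
- rewrite (@ge0_integral_affine R c 0
    (fun t => \int[lebesgue_tuple d]_w g (consT t w))%E)//.
    by rewrite muleA -EFinM exprSr invfM mulrC.
  by move=> t; exact: integral_ge0.
- have mh : measurable_fun setT (fun t : R => c * t + 0).
    by apply: measurable_funD => //; exact: measurable_funM.
  exact: (measurableT_comp mG mh).
- by move=> t _; exact: integral_ge0.
Qed.

(** * The volume of the unit ball *)

Lemma measurable_preimageT d d' (T : measurableType d) (U : measurableType d')
    (f : T -> U) (A : set U) :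
  measurable_fun setT f -> measurable A -> measurable (f @^-1` A).
Proof. by move=> mf mA; rewrite -[X in measurable X]setTI; exact: mf. Qed.

Lemma measurable_le d (T : measurableType d) (R : realType) (f g : T -> R) :
  measurable_fun setT f -> measurable_fun setT g ->
  measurable [set x | f x <= g x].
Proof.
move=> mf mg.
rewrite (_ : [set x | _] = (fun x => g x - f x) @^-1` `[0, +oo[).
  by apply: measurable_preimageT => //; exact: measurable_funB.
by apply/seteqP; split => x /=; rewrite in_itv/= andbT subr_ge0.
Qed.

Lemma integral_gauss_tuple (R : realType) (d : nat) :
  (\int[lebesgue_tuple d]_v (expR (- nsq v))%:E =
   (Num.sqrt (pi : R) ^+ d)%:E)%E.
Proof.
have mg n : measurable_fun [set: n.-tuple (measurableTypeR R)]
    (fun v => (expR (- nsq v))%:E).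
  apply/measurable_EFinP; apply: measurableT_comp => //.
  by apply: measurableT_comp => //; exact: measurable_nsq.
elim: d => [|d IH].
  rewrite /= integral_dirac//; last exact: (mg 0).
  by rewrite diracE in_setT mul1e /nsq big_ord0 oppr0 expR0.
rewrite integral_lebesgue_tupleS//.
transitivity (\int[@lebesgue_measure R]_t
    ((Num.sqrt (pi : R) ^+ d)%:E * (gauss_fun t)%:E))%E.
  apply: eq_integral => t _; rewrite -IH muleC -ge0_integralZl//; last 2 first.
  - exact: mg.
  - by rewrite lee_fin gauss_fun_ge0.
  by apply: eq_integral => w _; rewrite nsq_cons opprD expRD EFinM.
rewrite ge0_integralZl//.
- by rewrite integralT_gauss -EFinM -exprSr.
- by apply/measurable_EFinP; exact: measurable_gauss_fun.
- by move=> t _; rewrite lee_fin gauss_fun_ge0.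
Qed.

(** Indexed by the squared radius, so that [s] can serve as the integration variable against
    [expR (- s)]. *)
Definition cball (R : realType) (d : nat) (s : R) :
  set (d.-tuple (measurableTypeR R)) := [set v | nsq v <= s].
Arguments cball {R} d s.

Section ball.
Context (R : realType) (d : nat).
Local Notation L := (@lebesgue_tuple R d).

(** Kept as an extended real until [ball_volume_Gamma] shows that it is finite. *)
Definition unit_ball_volume : \bar R := L (cball d 1).

Lemma measurable_cball (s : R) :
  measurable (cball d s).
Proof. by apply: measurable_le => //; exact: measurable_nsq. Qed.

Lemma ball_volume (s : R) : 0 < s ->
  (L (cball d s) = (Num.sqrt s ^+ d)%:E * unit_ball_volume)%E.
Proof.
move=> s0; pose c := (Num.sqrt s)^-1.
have s0' : 0 < Num.sqrt s by rewrite sqrtr_gt0.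
have c0 : 0 < c by rewrite invr_gt0.
have E : (\int[L]_v (\1_(cball d 1) (dilate c v))%:E =
    (c ^- d)%:E * \int[L]_v (\1_(cball d 1) v)%:E)%E.
  rewrite (@ge0_integral_dilate R d c (fun v => (\1_(cball d 1) v)%:E))//.
  by apply/measurable_EFinP; apply: measurable_indic; exact: measurable_cball.
rewrite [in RHS]integral_indic ?setIT -?exprVn ?invrK in E; last 2 first.
- exact: measurableT.
- exact: measurable_cball.
rewrite -E; transitivity (\int[L]_v (\1_(cball d s) v)%:E)%E.
  by rewrite integral_indic ?setIT//; exact: measurable_cball.
apply: eq_integral => v _; congr EFin; apply: eq_indic.
by rewrite /cball/= nsq_dilate /c exprVn (sqr_sqrtr (ltW s0)) (ler_pdivrMl _ _ s0) mulr1.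
Qed.

Lemma ball_volume_lt0 (s : R) : s < 0 -> (L (cball d s) = 0)%E.
Proof.
move=> s0; rewrite (_ : cball d s = set0) ?measure0//.
apply/seteqP; split => // v /= /le_lt_trans /(_ s0).
by rewrite ltNge nsq_ge0.
Qed.

End ball.

(** [Gamma] before [fine] is applied, so that identities can be stated without knowing that the
    integral converges. *)
Definition eGamma (R : realType) (a : R) : \bar R :=
  (\int[lebesgue_measure]_(t in `]0%R, +oo[) (t `^ (a - 1) * expR (- t))%:E)%E.

Lemma eGamma_ge0 (R : realType) (a : R) : (0 <= eGamma a)%E.
Proof.
by apply: integral_ge0 => t _; rewrite lee_fin mulr_ge0 ?powR_ge0 ?expR_ge0.
Qed.

Lemma measurable_expRN (R : realType) : measurable_fun setT (fun t : R => expR (- t)).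
Proof. by apply: measurableT_comp => //; exact: measurable_expR. Qed.

(* Both members are [\int\int e^-s 1_(|v|^2 <= s) dv ds]. *)
Lemma ball_volume_eGamma (R : realType) (d : nat) :
  (unit_ball_volume R d * eGamma (d%:R / 2 + 1) =
   (Num.sqrt (pi : R) ^+ d)%:E)%E.
Proof.
pose A : set (measurableTypeR R * d.-tuple (measurableTypeR R)) :=
  [set p | nsq p.2 <= p.1].
have mA : measurable A.
  apply: measurable_le => //.
  by apply: measurableT_comp => //; exact: measurable_nsq.
pose h (p : measurableTypeR R * d.-tuple (measurableTypeR R)) : \bar R :=
  (expR (- p.1) * \1_A p)%:E.
have mh : measurable_fun setT h.
  apply/measurable_EFinP; apply: measurable_funM; last exact: measurable_indic.
  by apply: (measurableT_comp (@measurable_expRN R)).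
have h0 p : (0 <= h p)%E by rewrite lee_fin mulr_ge0// expR_ge0.
rewrite -integral_gauss_tuple.
transitivity (\int[lebesgue_tuple d]_v \int[lebesgue_measure]_s h (s, v))%E;
    last first.
  apply: eq_integral => v _; rewrite -integral_expRN [RHS]integral_mul_indic.
  apply: eq_integral => s _; congr (_ * _)%:E; apply: eq_indic.
  by rewrite /A/= in_itv/= andbT.
rewrite -(@fubini_tonelli _ _ _ _ _ lebesgue_measure (lebesgue_tuple d) h)//.
transitivity (\int[@lebesgue_measure R]_s ((expR (- s))%:E *
    lebesgue_tuple d (cball d s)))%E; last first.
  apply: eq_integral => s _.
  transitivity (\int[lebesgue_tuple d]_v ((expR (- s))%:E *
      (\1_(cball d s) v)%:E))%E.
    rewrite ge0_integralZl//; last first.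
      by apply/measurable_EFinP; apply: measurable_indic; exact: measurable_cball.
    by rewrite integral_indic ?setIT//; exact: measurable_cball.
  by apply: eq_integral => v _; rewrite -EFinM; congr (_ * _)%:E; exact: eq_indic.
have mS : measurable_fun setT (fun s : R => lebesgue_tuple d (cball d s)).
  have := @measurable_fun_xsection _ _ _ _ _ (lebesgue_tuple d) A mA.
  rewrite (_ : _ \o _ = (fun s => lebesgue_tuple d (cball d s)))//.
  apply/funext => s /=; congr (lebesgue_tuple d _).
  by apply/seteqP; split => v; rewrite /xsection/= ?inE.
have mF : measurable_fun setT
    (fun s : R => (expR (- s))%:E * lebesgue_tuple d (cball d s))%E.
  apply: emeasurable_funM => //; apply/measurable_EFinP.
  exact: measurable_expRN.
rewrite muleC /eGamma -ge0_integralZr//; last 2 first.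
- apply/measurable_EFinP; apply: measurable_funTS; apply: measurable_funM.
    exact: measurable_powR.
  exact: measurable_expRN.
- by move=> t _; rewrite lee_fin mulr_ge0 ?powR_ge0 ?expR_ge0.
(* Balls with negative [s] are empty. The point 0 is dropped next, since [ball_volume] asks for
   [0 < s]. *)
transitivity (\int[@lebesgue_measure R]_(s in `[0%R, +oo[)
    ((expR (- s))%:E * lebesgue_tuple d (cball d s)))%E; last first.
  rewrite integral_mkcond; apply: eq_integral => s _.
  rewrite patchE; case: ifPn => //; rewrite notin_setE/= in_itv/= andbT.
  by move=> /negP; rewrite -ltNge => s0; rewrite ball_volume_lt0// mule0.
rewrite -integral_itv_obnd_cbnd; last exact: measurable_funTS.
apply: eq_integral => s; rewrite inE/= in_itv/= andbT => s0.
rewrite ball_volume// muleA; congr (_ * _)%E.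
rewrite -EFinM mulrC addrK; congr (_ * _)%:E.
rewrite -powR12_sqrt ?ltW// -powR_mulrn ?powR_ge0// -powRrM.
by rewrite mulrC.
Qed.

(** Fubini replaces integration by parts, so that infinite values are allowed: write [t^a] as the
    integral of [a s^(a - 1)] over []0, t]], exchange, and use that [expR (- t)] integrates to
    [expR (- s)] over [[s, +oo[]. *)
Lemma eGammaS (R : realType) (a : R) : 0 < a ->
  (eGamma (a + 1) = a%:E * eGamma a)%E.
Proof.
move=> a0.
pose A : set (measurableTypeR R * measurableTypeR R) :=
  [set p | 0 < p.2 <= p.1].
have mA : measurable A.
  rewrite (_ : A = [set p | p.2 <= p.1] `&` ~` [set p | p.2 <= 0]).
    apply: measurableI; first exact: measurable_le.
    by apply: measurableC; exact: measurable_le.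
  apply/seteqP; split => p; rewrite /A/=.
    by move=> /andP[? ->]; split => //; apply/negP; rewrite -ltNge.
  by move=> [-> /negP]; rewrite -ltNge andbT.
pose h (p : measurableTypeR R * measurableTypeR R) : \bar R :=
  (a * p.2 `^ (a - 1) * expR (- p.1) * \1_A p)%:E.
have mh : measurable_fun setT h.
  apply/measurable_EFinP; apply: measurable_funM; last exact: measurable_indic.
  apply: measurable_funM; last first.
    exact: (measurableT_comp (@measurable_expRN R)).
  apply: measurable_funM => //.
  exact: (measurableT_comp (@measurable_powR R (a - 1))).
have h0 p : (0 <= h p)%E.
  by rewrite lee_fin !mulr_ge0 ?expR_ge0 ?powR_ge0// ltW.
transitivity (\int[lebesgue_measure]_t \int[lebesgue_measure]_s h (t, s))%E.
  rewrite /eGamma integral_mul_indic; apply: eq_integral => t _.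
  have [t0|t0] := leP t 0.
    rewrite indicE memNset/= ?in_itv/= ?andbT ?ltNge ?t0// mulr0.
    rewrite (eq_integral (cst 0%E)) ?integral0// => s _.
    rewrite /h indicE memNset ?mulr0// /A/= => /andP[s0 st].
    by have := lt_le_trans s0 (le_trans st t0); rewrite ltxx.
  rewrite indicE mem_set/= ?in_itv/= ?andbT// mulr1 addrK EFinM -integral_powR ?ltW//.
  rewrite -ge0_integralZr//.
  - under eq_integral do rewrite -EFinM.
    rewrite integral_mul_indic; apply: eq_integral => s _.
    by congr (_ * _)%:E; apply: eq_indic; rewrite /A/= in_itv.
  - apply/measurable_EFinP; apply: measurable_funTS; apply: measurable_funM => //.
  - by move=> s _; rewrite lee_fin mulr_ge0 ?powR_ge0// ltW.
rewrite (@fubini_tonelli _ _ _ _ _ lebesgue_measure lebesgue_measure h)//.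
rewrite /eGamma -ge0_integralZl//; last 3 first.
- apply/measurable_EFinP; apply: measurable_funTS; apply: measurable_funM.
    exact: measurable_powR.
  exact: measurable_expRN.
- by move=> s _; rewrite lee_fin mulr_ge0 ?powR_ge0 ?expR_ge0.
- by rewrite lee_fin ltW.
rewrite [RHS]integral_mkcond; apply: eq_integral => s _.
rewrite patchE; case: ifPn; last first.
  move=> s0; rewrite (eq_integral (cst 0%E)) ?integral0// => t _.
  rewrite /h indicE memNset ?mulr0// /A/= => /andP[+ _].
  by move: s0; rewrite notin_setE/= in_itv/= andbT.
rewrite inE/= in_itv/= andbT => s0.
rewrite EFinM -integral_expRN muleA -EFinM -ge0_integralZl//.
- under [RHS]eq_integral do rewrite -EFinM.
  rewrite [RHS]integral_mul_indic; apply: eq_integral => t _.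
  by congr (_ * _)%:E; apply: eq_indic; rewrite /A/= in_itv/= andbT s0.
- by apply/measurable_EFinP; apply: measurable_funTS; exact: measurable_expRN.
- by rewrite lee_fin mulr_ge0 ?powR_ge0// ltW.
Qed.

(** Finiteness is deduced from the product: an infinite factor would make it 0 or infinite, and a
    zero factor would make it 0, whereas it equals a positive power of the square root of pi. *)
Lemma ball_volume_Gamma (R : realType) (d : nat) : (0 < d)%N ->
  exists c : R, [/\ unit_ball_volume R d = c%:E, 0 < c, 0 < Gamma (d%:R / 2 : R) &
    c * (d%:R / 2) * Gamma (d%:R / 2) = Num.sqrt pi ^+ d].
Proof.
move=> d0; have d2 : 0 < (d%:R / 2 : R) by rewrite divr_gt0// ltr0n.
have pid : 0 < Num.sqrt (pi : R) ^+ d by rewrite exprn_gt0// sqrtr_gt0 pi_gt0.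
have := ball_volume_eGamma R d; rewrite eGammaS//.
have k0 : (0 <= unit_ball_volume R d)%E by exact: measure_ge0.
have g0 : (0 <= eGamma (d%:R / 2 : R))%E by exact: eGamma_ge0.
have -> : Gamma (d%:R / 2 : R) = fine (eGamma (d%:R / 2)) by [].
case: (eGamma _) g0 => [g||]//= g0; case: (unit_ball_volume R d) k0 => [c||]//= c0.
- rewrite -!EFinM => -[E]; rewrite !lee_fin in c0 g0.
  exists c; split => //.
  + rewrite lt_def c0 andbT; apply/eqP => c00.
    by move: pid; rewrite -E c00 mul0r ltxx.
  + rewrite lt_def g0 andbT; apply/eqP => g00.
    by move: pid; rewrite -E g00 !mulr0 ltxx.
  + by rewrite -E mulrA.
- rewrite -EFinM; have [->|g00] := eqVneq g 0.
    by rewrite mulr0 mule0 => -[E]; move: pid; rewrite -E ltxx.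
  by rewrite gt0_mulye// lte_fin mulr_gt0// lt_def g00 -lee_fin.
- rewrite gt0_muley ?lte_fin//; have [->|c00] := eqVneq c 0.
    by rewrite mul0e => -[E]; move: pid; rewrite -E ltxx.
  by rewrite gt0_muley// lte_fin lt_def c00 -lee_fin.
- by rewrite gt0_muley ?lte_fin// mulyy.
Qed.

(** The ball of radius 0 is the origin, contained in arbitrarily small balls. This settles the value
    [s = 0] in [radial_moment] and the axis of the cones in [sphere_area_poles]. *)
Lemma ball_volume0 (R : realType) (d : nat) (c : R) : (0 < d)%N ->
  unit_ball_volume R d = c%:E -> lebesgue_tuple d (cball d (0 : R)) = 0%E.
Proof.
move=> d0 cE.
have c0 : 0 <= c by rewrite -lee_fin -cE; exact: measure_ge0.
apply/eqP; rewrite eq_le measure_ge0 andbT; apply/lee_addgt0Pr => e e0.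
rewrite add0e.
(* The radius is at most 1, so that its [d]-th power is at most itself; [c + 1] instead of [c]
   avoids a division by zero, as only [0 <= c] is known here. *)
have e' : 0 < Num.min 1 (e / (c + 1)) by rewrite lt_min ltr01/= divr_gt0// ltr_wpDl.
apply: (@le_trans _ _ (lebesgue_tuple d (cball d (Num.min 1 (e / (c + 1)) ^+ 2)))).
  apply: le_measure; rewrite ?inE; [exact: measurable_cball|exact: measurable_cball|].
  by move=> w; rewrite /cball/= => /le_trans; apply; exact: sqr_ge0.
rewrite ball_volume ?exprn_gt0// cE sqrtr_sqr (gtr0_norm e') -EFinM lee_fin.
apply: (@le_trans _ _ (Num.min 1 (e / (c + 1)) * c)).
  apply: ler_wpM2r => //; rewrite -[leRHS]expr1.
  by apply: ler_wiXn2l; [exact: ltW|rewrite ge_min lexx|exact: d0].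
apply: (@le_trans _ _ (e / (c + 1) * c)).
  by rewrite ler_wpM2r// ge_min lexx orbT.
rewrite mulrAC ler_pdivrMr; last by rewrite ltr_wpDl.
by apply: ler_wpM2l; [exact: ltW|rewrite lerDl ler01].
Qed.

(* Integrate [rho - |w|], the length of [[|w|, rho]], by Fubini. *)
Lemma radial_moment (R : realType) (d : nat) (c rho : R) : (0 < d)%N -> 0 < rho ->
  unit_ball_volume R d = c%:E ->
  (\int[lebesgue_tuple d]_w
     (Num.sqrt (nsq w) * \1_(cball d (rho ^+ 2)) w)%:E =
   (c * (d%:R / d.+1%:R) * rho ^+ d.+1)%:E)%E.
Proof.
move=> d0 rho0 cE.
have d1 : (d.+1%:R : R) != 0 by rewrite pnatr_eq0.
have dE : d.+1%:R - 1 = d%:R :> R by rewrite -natr1 addrK.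
have c0 : 0 <= c by rewrite -lee_fin -cE; exact: measure_ge0.
have mr : measurable_fun [set: d.-tuple (measurableTypeR R)]
    (fun w => Num.sqrt (nsq w)).
  apply: (@measurableT_comp _ _ _ _ _ _ (@Num.sqrt R)).
    by apply: continuous_measurable_fun; exact: sqrt_continuous.
  exact: measurable_nsq.
have r_le (w : d.-tuple (measurableTypeR R)) (s : R) : 0 <= s ->
    (Num.sqrt (nsq w) <= s) = (nsq w <= s ^+ 2).
  move=> s0; rewrite -[in LHS](ger0_norm s0) -sqrtr_sqr ler_sqrt//.
  exact: sqr_ge0.
pose A : set (d.-tuple (measurableTypeR R) * measurableTypeR R) :=
  [set p | Num.sqrt (nsq p.1) <= p.2] `&` [set p | p.2 <= rho].
have mA : measurable A.
  apply: measurableI; last exact: measurable_le.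
  by apply: measurable_le => //; exact: (measurableT_comp mr).
pose h (p : d.-tuple (measurableTypeR R) * measurableTypeR R) : \bar R :=
  (\1_A p)%:E.
have mh : measurable_fun setT h.
  by apply/measurable_EFinP; exact: measurable_indic.
have h0 p : (0 <= h p)%E by rewrite lee_fin.
have mI : measurable_fun setT (\1_(cball d (rho ^+ 2)) : _ -> R).
  by apply: measurable_indic; exact: measurable_cball.
have inner (w : d.-tuple (measurableTypeR R)) :
    (\int[lebesgue_measure]_s h (w, s) =
    ((rho - Num.sqrt (nsq w)) * \1_(cball d (rho ^+ 2)) w)%:E)%E.
  transitivity (\int[lebesgue_measure]_(s in setT)
      (\1_[set` `[Num.sqrt (nsq w), rho]%R] s)%:E)%E.
    apply: eq_integral => s _; congr EFin; apply: eq_indic.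
    rewrite /A/= in_itv/=; split; first by case=> -> ->.
    by move=> /andP[].
  rewrite integral_indic// setIT.
  transitivity (lebesgue_measure ([set` `[Num.sqrt (nsq w), rho]%R] : set R)) => //.
  rewrite lebesgue_measure_itv/= lte_fin; case: ltP => wr.
    rewrite indicE mem_set ?mulr1 ?EFinB//.
    by rewrite /cball/= -(r_le _ _ (ltW rho0)) ltW.
  have [->|wr'] := eqVneq (Num.sqrt (nsq w)) rho; first by rewrite subrr mul0r.
  rewrite indicE memNset ?mulr0// /cball/= -(r_le _ _ (ltW rho0)).
  by apply/negP; rewrite -ltNge lt_neqAle wr eq_sym wr'.
(* After the exchange, the section at fixed [s] is the ball of radius [s], so this is the integral
   of [c s^d] over [[0, rho]]. *)
have E1 : (\int[lebesgue_tuple d]_w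
    ((rho - Num.sqrt (nsq w)) * \1_(cball d (rho ^+ 2)) w)%:E =
    (c * rho ^+ d.+1 / d.+1%:R)%:E)%E.
  under eq_integral do rewrite -inner.
  rewrite (@fubini_tonelli _ _ _ _ _ (lebesgue_tuple d) lebesgue_measure h)//.
  have mc : measurable_fun setT (fun s : R =>
      (c / d.+1%:R * (d.+1%:R * s `^ (d.+1%:R - 1)))%:E).
    apply/measurable_EFinP; apply: measurable_funM => //.
    by apply: measurable_funM => //; exact: measurable_powR.
  transitivity (\int[@lebesgue_measure R]_(s in `]0%R, rho])
     ((c / d.+1%:R)%:E * (d.+1%:R * s `^ (d.+1%:R - 1))%:E))%E; last first.
    rewrite ge0_integralZl//.
    - by rewrite integral_powR ?ltr0n// ?ltW// powR_mulrn ?ltW// -EFinM mulrAC.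
    - apply/measurable_EFinP; apply: measurable_funM => //.
      by apply: measurable_funTS; exact: measurable_powR.
    - by move=> s _; rewrite lee_fin mulr_ge0 ?powR_ge0.
    - by rewrite lee_fin divr_ge0.
  under [RHS]eq_integral do rewrite -EFinM.
  rewrite integral_itv_obnd_cbnd; last exact: measurable_funTS.
  rewrite [RHS]integral_mul_indic; apply: eq_integral => s _.
  (* The section is empty for [s < 0] and for [s > rho]. At [s = 0], excluded from [ball_volume],
     both sides vanish: the left one by [ball_volume0], the right one because the exponent [d] is
     nonzero. *)
  have [s0|s0|s0] := ltgtP s 0.
  - rewrite (eq_integral (cst 0%E)) ?integral0.
      by rewrite indicE memNset ?mulr0//= in_itv/= leNgt s0.
    move=> w _; rewrite /h indicE memNset// /A/= => -[+ _].
    by rewrite leNgt (lt_le_trans s0)// sqrtr_ge0.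
  - have [sr|sr] := leP s rho; last first.
      rewrite (eq_integral (cst 0%E)) ?integral0.
        by rewrite indicE memNset ?mulr0//= in_itv/= (leNgt s) sr andbF.
      by move=> w _; rewrite /h indicE memNset// /A/= => -[_]; rewrite leNgt sr.
    transitivity (\int[lebesgue_tuple d]_w (\1_(cball d (s ^+ 2)) w)%:E)%E.
      apply: eq_integral => w _; congr EFin; apply: eq_indic.
      rewrite /A/= /cball/= -(r_le _ _ (ltW s0)); split => [[]//|-> //].
    transitivity (lebesgue_tuple d (cball d (s ^+ 2))).
      by rewrite integral_indic ?setIT//; exact: measurable_cball.
    rewrite ball_volume ?exprn_gt0// cE sqrtr_sqr gtr0_norm// -EFinM.
    rewrite indicE mem_set/= ?in_itv/= ?sr ?ltW// mulr1 mulrA divfK//.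
    by rewrite mulrC dE powR_mulrn// ltW.
  - rewrite s0 powR0 ?mulr0 ?mul0r; last first.
      by rewrite dE pnatr_eq0 -lt0n.
    transitivity (lebesgue_tuple d (cball d (0 : R))).
      transitivity (\int[lebesgue_tuple d]_w (\1_(cball d (0 : R)) w)%:E)%E; last first.
        by rewrite integral_indic ?setIT//; exact: measurable_cball.
      apply: eq_integral => w _; congr EFin; apply: eq_indic.
      rewrite /A/= /cball/= r_le// expr0n/=; split => [[]//|->].
      by split => //; exact: ltW.
    exact: ball_volume0 cE.
have E2 : (\int[lebesgue_tuple d]_w (rho * \1_(cball d (rho ^+ 2)) w)%:E =
    (c * rho ^+ d.+1)%:E)%E.
  under eq_integral do rewrite EFinM.
  rewrite ge0_integralZl//; last 2 first.
  - by apply/measurable_EFinP.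
  - by rewrite lee_fin ltW.
  transitivity (rho%:E * lebesgue_tuple d (cball d (rho ^+ 2)))%E.
    by rewrite integral_indic ?setIT//; exact: measurable_cball.
  rewrite ball_volume ?exprn_gt0// cE sqrtr_sqr gtr0_norm// -!EFinM.
  by rewrite mulrA -exprS mulrC.
(* Stated as a sum to stay with nonnegative integrands; the finite value from [E1] is subtracted
   afterwards. *)
have : (\int[lebesgue_tuple d]_w (rho * \1_(cball d (rho ^+ 2)) w)%:E =
  \int[lebesgue_tuple d]_w (Num.sqrt (nsq w) * \1_(cball d (rho ^+ 2)) w)%:E +
  \int[lebesgue_tuple d]_w
    ((rho - Num.sqrt (nsq w)) * \1_(cball d (rho ^+ 2)) w)%:E)%E.
  rewrite -ge0_integralD//.
  - by apply: eq_integral => w _; rewrite -EFinD -mulrDl addrC subrK.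
  - apply/measurable_EFinP; exact: measurable_funM.
  - by move=> w _; rewrite -inner integral_ge0.
  - apply/measurable_EFinP; apply: measurable_funM => //.
    exact: measurable_funB.
rewrite E1 E2 => /(congr1 (fun z => z - (c * rho ^+ d.+1 / d.+1%:R)%:E)%E).
rewrite addeK// => <-; rewrite -EFinB; congr EFin.
have -> : d%:R = d.+1%:R - 1 :> R by rewrite dE.
by field.
Qed.

(** * Slices of cones and of the sphere *)

Section polar_section.
Context (R : realType) (r : R).
Hypothesis r0 : 0 < r.

(** For a point [(t, w)] of R^(d+1) with |w| = [r], [psi t] is the first coordinate of the
    normalized point. [phi] inverts it on []-1, 1[], and the [w] of this section is the derivative
    of [phi]. *)
Let psi (t : R) : R := t / Num.sqrt (t ^+ 2 + r ^+ 2).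
Let phi (u : R) : R := r * (u * (1 - u ^+ 2) `^ (- 2^-1)).
Let w (u : R) : R := r * (1 - u ^+ 2) `^ (- (3 / 2)).

(** The product rule gives [(1 - u^2)^(-1/2) + u^2 (1 - u^2)^(-3/2)], which collapses to
    [(1 - u^2)^(-3/2)]. *)
Lemma is_derive_phi (u : R) : -1 < u < 1 -> is_derive u 1 phi (w u).
Proof.
move=> /andP[u1 u2].
have q0 : 0 < 1 - u ^+ 2 by nra.
have H : is_derive u 1 (fun x : R => (1 - x ^+ 2) `^ (- 2^-1))
  ((- 2^-1 * (1 - u ^+ 2) `^ (- 2^-1 - 1)) * (0 - (u + u))).
  apply: (@is_derive1_comp _ (fun y => y `^ (- 2^-1)) (fun x => 1 - x ^+ 2)).
    exact: is_derive1_powR.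
  by apply: is_deriveB; rewrite /= ; apply: is_derive_eq; rewrite /GRing.scale/=; ring.
apply: is_derive_eq.
rewrite /GRing.scale/= /w.
have -> : - 2^-1 - 1 = - (3 / 2) :> R by lra.
have -> : (1 - u ^+ 2) `^ (- 2^-1) = (1 - u ^+ 2) `^ (- (3 / 2)) * (1 - u ^+ 2).
  rewrite -[X in _ * X]powRr1 ?ltW// -powRD; last by apply/implyP => _; rewrite gt_eqF.
  by congr (_ `^ _); lra.
by field.
Qed.

Let powRNhalf (a : R) : 0 < a -> (a ^+ 2) `^ (- 2^-1) = a^-1.
Proof.
by move=> a0; rewrite powRN powR12_sqrt ?sqr_ge0// sqrtr_sqr gtr0_norm.
Qed.

Let psi_itv t : -1 < psi t < 1.
Proof.
have s0 : 0 < Num.sqrt (t ^+ 2 + r ^+ 2).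
  by rewrite sqrtr_gt0 ltr_wpDl ?sqr_ge0// exprn_gt0.
rewrite -ltr_norml normrM normfV (gtr0_norm s0) ltr_pdivrMr// mul1r.
by rewrite -sqrtr_sqr ltr_sqrt ?ltrDl ?exprn_gt0// ltr_wpDl ?sqr_ge0// exprn_gt0.
Qed.

Let psi_lt x y : x < y -> psi x < psi y.
Proof.
move=> xy; rewrite /psi.
have S z : 0 < z ^+ 2 + r ^+ 2 by rewrite ltr_wpDl ?sqr_ge0// exprn_gt0.
have := sqr_sqrtr (ltW (S x)); have := sqr_sqrtr (ltW (S y)).
have : 0 < Num.sqrt (x ^+ 2 + r ^+ 2) by rewrite sqrtr_gt0.
have : 0 < Num.sqrt (y ^+ 2 + r ^+ 2) by rewrite sqrtr_gt0.
move: (Num.sqrt (x ^+ 2 + _)) (Num.sqrt (y ^+ 2 + _)) => a b b0 a0 b2 a2.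
rewrite ltr_pdivrMr// mulrAC ltr_pdivlMr// -subr_gt0.
(* The difference of squares removes the square roots. When [x] and [y] have the same sign,
   [y a + x b] and [x + y] share it; when [x < 0 <= y] the inequality is immediate. *)
have E : (y * a - x * b) * (y * a + x * b) = r ^+ 2 * ((y - x) * (y + x)).
  by rewrite -subr_sqr !exprMn a2 b2; ring.
have r2 : 0 < r ^+ 2 by rewrite exprn_gt0.
have [x0|x0] := leP 0 x.
  have y0 : 0 < y by exact: le_lt_trans xy.
  have P : 0 < y * a + x * b by rewrite ltr_pwDl ?mulr_gt0// mulr_ge0// ltW.
  by rewrite -(pmulr_lgt0 _ P) E !mulr_gt0 ?subr_gt0// ltr_wpDr.
have [y0|y0] := leP 0 y.
  by rewrite subr_gt0 (lt_le_trans (y := 0))// ?nmulr_rlt0// mulr_ge0// ltW.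
have P : y * a + x * b < 0.
  by rewrite -oppr_gt0 opprD addr_gt0// -mulNr mulr_gt0// oppr_gt0.
rewrite -(nmulr_llt0 _ P) E pmulr_rlt0// pmulr_rlt0 ?subr_gt0//.
by rewrite -oppr_gt0 opprD addr_gt0// oppr_gt0.
Qed.

Let phiK t : phi (psi t) = t.
Proof.
rewrite /phi /psi.
have S : 0 < t ^+ 2 + r ^+ 2 by rewrite ltr_wpDl ?sqr_ge0// exprn_gt0.
have := sqr_sqrtr (ltW S); have : 0 < Num.sqrt (t ^+ 2 + r ^+ 2) by rewrite sqrtr_gt0.
move: (Num.sqrt _) => s s0 s2.
have -> : 1 - (t / s) ^+ 2 = (r / s) ^+ 2.
  have -> : 1 = (t ^+ 2 + r ^+ 2) / s ^+ 2 by rewrite -s2 divff// expf_neq0// gt_eqF.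
  by rewrite !exprMn exprVn -mulrBl addrAC subrr add0r.
rewrite powRNhalf ?divr_gt0//; field.
by rewrite !gt_eqF.
Qed.

(** The point [(phi u, r)] is [r / sqrt (1 - u^2)] times the unit vector [(u, sqrt (1 - u^2))].
    Hence lying in the unit ball becomes the condition [r^2 <= 1 - u^2]. *)
Let phi_sqr u : -1 < u < 1 ->
  phi u = r * u / Num.sqrt (1 - u ^+ 2) /\
  phi u ^+ 2 + r ^+ 2 = (r / Num.sqrt (1 - u ^+ 2)) ^+ 2.
Proof.
move=> /andP[u1 u2]; have q0 : 0 < 1 - u ^+ 2 by nra.
have := sqr_sqrtr (ltW q0); have : 0 < Num.sqrt (1 - u ^+ 2) by rewrite sqrtr_gt0.
rewrite /phi; move: (Num.sqrt _) => s s0 s2.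
have -> : (1 - u ^+ 2) `^ (- 2^-1) = s^-1 by rewrite -s2 powRNhalf.
split; first by rewrite mulrA.
have -> : r ^+ 2 = r ^+ 2 * (1 - u ^+ 2) / s ^+ 2.
  by rewrite -s2 mulfK// expf_neq0// gt_eqF.
by field; rewrite gt_eqF.
Qed.

Let psiK u : -1 < u < 1 -> psi (phi u) = u.
Proof.
move=> u1; have [E1 E2] := phi_sqr u1; rewrite /psi E2 {1}E1 sqrtr_sqr.
have q0 : 0 < 1 - u ^+ 2 by move: u1 => /andP[? ?]; nra.
have s0 : 0 < Num.sqrt (1 - u ^+ 2) by rewrite sqrtr_gt0.
rewrite gtr0_norm ?divr_gt0//; field.
by rewrite !gt_eqF.
Qed.

Let mq p : measurable_fun setT (fun u : R => (1 - u ^+ 2) `^ p).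
Proof.
apply: (measurableT_comp (@measurable_powR R p)).
by apply: measurable_funB => //; exact: measurable_funX.
Qed.

(** The indicator discards the [u] outside []-1, 1[], where the powers have a nonpositive base and
    take default values. *)
Lemma lebesgue_polar (A : set R) : measurable A ->
  (lebesgue_measure A = \int[lebesgue_measure]_u
    ((w u * \1_(`]-1, 1[%classic : set R) u)%:E * (\1_A (phi u))%:E))%E.
Proof.
move: A; apply: lebesgue_density_unique.
- apply: measurable_funM => //; apply: measurable_funM => //; exact: mq.
- apply: measurable_funM; last exact: measurable_indic.
  by apply: measurable_funM => //; exact: mq.
- by move=> u; rewrite !mulr_ge0 ?powR_ge0// ltW.
move=> x y xy.
transitivity (\int[@lebesgue_measure R]_(u in `]psi x, psi y]) (w u)%:E)%E.
  rewrite [RHS]integral_mul_indic; apply: eq_integral => u _.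
  rewrite -EFinM -mulrA; congr (_ * _)%:E.
  rewrite -[X in X = _]/((\1_`]-1, 1[ \* (\1_`]x, y] \o phi)) u : R).
  transitivity (\1_(`]-1, 1[%classic `&` phi @^-1` `]x, y]) u : R).
    by rewrite indicI.
  apply: eq_indic; rewrite /= !in_itv/=.
  have psi_lt_mono a b : (psi a < psi b) = (a < b).
    exact: (leW_mono (le_mono psi_lt)).
  split=> [[u1 /andP[xu uy]]|/andP[xu uy]].
    by rewrite -(psiK u1) psi_lt_mono xu (le_mono psi_lt).
  have u1 : -1 < u < 1.
    have /andP[h _] := psi_itv x; have /andP[_ h'] := psi_itv y.
    by rewrite (lt_trans h xu) (le_lt_trans uy h').
  by move: xu uy; rewrite -(psiK u1) psi_lt_mono (le_mono psi_lt) (psiK u1) => -> ->.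
transitivity ((phi (psi y))%:E - (phi (psi x))%:E)%E; last by rewrite !phiK.
have itv u : psi x <= u <= psi y -> -1 < u < 1.
  move=> /andP[xu uy].
  have /andP[h _] := psi_itv x; have /andP[_ h'] := psi_itv y.
  by rewrite (lt_le_trans h xu) (le_lt_trans uy h').
apply: integral_is_derive; first exact: psi_lt.
  by move=> u /itv; exact: is_derive_phi.
move=> u /itv /andP[u1 u2]; apply: continuousM; first exact: cst_continuous.
apply: (@continuous_comp _ _ _ (fun u : R => 1 - u ^+ 2) (fun y => y `^ (- (3 / 2)))).
  by apply: continuousB; [exact: cst_continuous|exact: exprn_continuous].
by apply: continuous_powR; nra.
Qed.

(** The set on the left is the section, at fixed [w] with |w| = [r], of the cone over the part of
    the sphere whose heights lie in [B]. *)
Lemma lebesgue_polar_section (B : set R) : measurable B -> B `<=` `]-1, 1[ ->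
  lebesgue_measure
    [set t : R | t ^+ 2 + r ^+ 2 <= 1 /\ B (t / Num.sqrt (t ^+ 2 + r ^+ 2))] =
  (\int[lebesgue_measure]_u ((r * (1 - u ^+ 2) `^ (- (3 / 2)) *
    \1_[set v : R | B v /\ r ^+ 2 <= 1 - v ^+ 2] u)%R)%:E)%E.
Proof.
move=> mB BI.
have mpsi : measurable_fun setT psi.
  rewrite (_ : psi = (fun t => t * (t ^+ 2 + r ^+ 2) `^ (- 2^-1))).
    apply: measurable_funM => //; apply: (measurableT_comp (@measurable_powR R _)).
    by apply: measurable_funD => //; exact: measurable_funX.
  apply/funext => t; rewrite /psi powRN powR12_sqrt//.
  by rewrite addr_ge0// sqr_ge0.
rewrite lebesgue_polar; last first.
  apply: measurableI; last exact: measurable_preimageT.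
  by apply: measurable_le => //; apply: measurable_funD => //; exact: measurable_funX.
apply: eq_integral => u _; rewrite -EFinM; congr EFin.
rewrite -[LHS]mulrA; congr (_ * _).
transitivity (\1_(`]-1, 1[%classic `&`
    phi @^-1` [set t | t ^+ 2 + r ^+ 2 <= 1 /\ B (psi t)]) u : R).
  by rewrite indicI.
apply: eq_indic; rewrite /= in_itv/=.
have H : -1 < u < 1 -> (phi u ^+ 2 + r ^+ 2 <= 1) = (r ^+ 2 <= 1 - u ^+ 2).
  move=> u1; have q0 : 0 < 1 - u ^+ 2 by move: u1 => /andP[? ?]; nra.
  have [_ ->] := phi_sqr u1.
  by rewrite expr_div_n sqr_sqrtr ?(ltW q0)// ler_pdivrMr// mul1r.
split=> [[u1 [h Bu]]|[Bu h]].
  by rewrite -H//; move: Bu; rewrite psiK.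
have u1 : -1 < u < 1 by have := BI _ Bu; rewrite /= in_itv.
by rewrite psiK// H.
Qed.
End polar_section.

Section sphere_slice.
Context (R : realType) (d : nat) (c : R).
Hypotheses (d0 : (0 < d)%N) (cE : unit_ball_volume R d = c%:E).
Local Notation T := (d.+1.-tuple (measurableTypeR R)).

Lemma measurable_thead : measurable_fun [set: T] (fun v => thead v : R).
Proof. exact: measurable_tnth. Qed.

Lemma measurable_enorm : measurable_fun [set: T] (fun v => enorm v).
Proof.
apply: (@measurableT_comp _ _ _ _ _ _ (@Num.sqrt R)).
  by apply: continuous_measurable_fun; exact: sqrt_continuous.
exact: measurable_nsq.
Qed.

Lemma measurable_sphere : measurable (sphere d : set T).
Proof. exact: (measurable_preimageT measurable_enorm (measurable_set1 1)). Qed.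

Lemma enorm_cons (t : R) (w : d.-tuple (measurableTypeR R)) :
  enorm (consT t w) = Num.sqrt (t ^+ 2 + Num.sqrt (nsq w) ^+ 2).
Proof. by rewrite sqr_sqrtr ?nsq_ge0// -nsq_cons. Qed.

Lemma thead_scalet (a : R) (v : T) : thead (scalet a v) = a * (thead v : R).
Proof. by rewrite /thead tnth_mktuple. Qed.

Lemma thead_cons (t : R) (w : d.-tuple (measurableTypeR R)) :
  thead (consT t w) = t.
Proof. by []. Qed.

Lemma enorm_normalize (v : T) : 0 < enorm v -> enorm (scalet (enorm v)^-1 v) = 1.
Proof.
move=> v0; rewrite {1}/enorm.
have -> : \sum_i (tnth (scalet (enorm v)^-1 v) i : R) ^+ 2 =
    (enorm v)^-1 ^+ 2 * nsq v.
  by rewrite /nsq mulr_sumr; apply: eq_bigr => i _; rewrite tnth_mktuple exprMn.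
have -> : nsq v = enorm v ^+ 2 by rewrite sqr_sqrtr// nsq_ge0.
by rewrite -exprMn mulVf ?gt_eqF// expr1n sqrtr1.
Qed.

Definition slice (B : set R) : set T := [set v | enorm v = 1 /\ B (thead v)].

Lemma cone_slice (B : set R) (v : T) :
  cone (slice B) v <-> 0 < enorm v <= 1 /\ B (thead v / enorm v).
Proof.
rewrite /cone /slice/=; split => [[v1 [_]]|[v1 Bv]].
  by rewrite thead_scalet mulrC.
split=> //; split; last by rewrite thead_scalet mulrC.
by apply: enorm_normalize; have /andP[] := v1.
Qed.

Lemma measurable_cone_slice (B : set R) : measurable B ->
  measurable (cone (slice B)).
Proof.
move=> mB.
rewrite (_ : cone (slice B) = (fun v => enorm v) @^-1` `]0, 1] `&`
    (fun v => thead v * (enorm v `^ (- 1))) @^-1` B).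
  apply: measurableI; first exact: (measurable_preimageT measurable_enorm).
  apply: measurable_preimageT => //; apply: measurable_funM.
    exact: measurable_thead.
  exact: (measurableT_comp (@measurable_powR R (- 1)) measurable_enorm).
apply/seteqP; split => v; rewrite /= in_itv/= powR_inv1 ?sqrtr_ge0//.
  by move=> /cone_slice.
by move=> H; apply/cone_slice.
Qed.

(** At fixed [w] the cone has length equal to the integral over [B] of [|w| (1 - u^2)^(-3/2)],
    restricted to [|w|^2 <= 1 - u^2]. Exchanging, [radial_moment] with [rho = sqrt (1 - u^2)] gives
    [c d / (d + 1) (1 - u^2)^((d + 1)/2)]. The exponents add up to [(d - 2)/2], and [d + 1] cancels
    against the factor in [sphere_area]. *)
Lemma sphere_area_slice (B : set R) : measurable B -> B `<=` `]-1, 1[ ->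
  sphere_area d (slice B) = (\int[lebesgue_measure]_u
    (d%:R * c * (1 - u ^+ 2) `^ ((d%:R - 2) / 2) * \1_B u)%R%:E)%E.
Proof.
move=> mB BI.
pose D (r : R) : set R := [set v | B v /\ r ^+ 2 <= 1 - v ^+ 2].
pose q (u : R) : R := (1 - u ^+ 2) `^ (- (3 / 2)).
have mq p : measurable_fun setT (fun u : R => (1 - u ^+ 2) `^ p).
  apply: (measurableT_comp (@measurable_powR R p)).
  by apply: measurable_funB => //; exact: measurable_funX.
have inner (w : d.-tuple (measurableTypeR R)) :
    (\int[lebesgue_measure]_t (\1_(cone (slice B)) (consT t w))%:E =
     \int[lebesgue_measure]_u
       (Num.sqrt (nsq w) * q u * \1_(D (Num.sqrt (nsq w))) u)%:E)%E.
  have := sqrtr_ge0 (nsq w).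
  have H t := cone_slice B (consT t w).
  have N t := enorm_cons t w.
  (* The substitution needs [r > 0]. For [w = 0] the normalized height is 1 or -1, outside [B], so
     both sides are 0. *)
  rewrite le_eqVlt => /predU1P[r0|r0].
    rewrite (eq_integral (cst 0%E)); last first.
      move=> t _; congr EFin; rewrite indicE memNset// => /H.
      rewrite N -r0 expr0n addr0 sqrtr_sqr thead_cons => -[/andP[t0 _]] /BI.
      rewrite /= in_itv/= -ltr_norml normrM normfV normr_id divff ?ltxx//.
      by rewrite gt_eqF.
    by rewrite [RHS](eq_integral (cst 0%E))// => u _; rewrite -r0 !mul0r.
  rewrite -(lebesgue_polar_section r0 mB BI).
  move: r0 N H; move: (Num.sqrt (nsq w)) => r r0 N H.
  transitivity (\int[@lebesgue_measure R]_t (\1_[set t : R |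
      t ^+ 2 + r ^+ 2 <= 1 /\ B (t / Num.sqrt (t ^+ 2 + r ^+ 2))] t)%:E)%E.
    apply: eq_integral => t _; congr EFin; apply: eq_indic.
    apply: (iff_trans (H t)); rewrite N thead_cons/=.
    have P : 0 < t ^+ 2 + r ^+ 2 by rewrite ltr_wpDl ?sqr_ge0// exprn_gt0.
    by rewrite sqrtr_gt0 P/= -[X in _ <= X]sqrtr1 ler_sqrt// ltr01.
  rewrite integral_indic ?setIT//; apply: measurableI.
    by apply: measurable_le => //; apply: measurable_funD => //; exact: measurable_funX.
  have mpsi : measurable_fun setT (fun t : R => t * (t ^+ 2 + r ^+ 2) `^ (- 2^-1)).
    apply: measurable_funM => //; apply: (measurableT_comp (@measurable_powR R _)).
    by apply: measurable_funD => //; exact: measurable_funX.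
  have := measurable_preimageT mpsi mB; congr measurable.
  apply/seteqP; split => t /=; by rewrite powRN powR12_sqrt// addr_ge0// sqr_ge0.
have mS : measurable (cone (slice B)) by exact: measurable_cone_slice.
rewrite /sphere_area -[lebesgue_tuple d.+1 _]/((lebesgue_tuple d.+1 : measure _ _) _).
transitivity (d.+1%:R%:E *
    \int[lebesgue_tuple d.+1]_v (\1_(cone (slice B)) v)%:E)%E.
  by rewrite integral_indic// setIT.
rewrite integral_lebesgue_tupleS_swap//; last first.
  by apply/measurable_EFinP; exact: measurable_indic.
under eq_integral do rewrite inner.
pose A : set (d.-tuple (measurableTypeR R) * measurableTypeR R) :=
  [set p | nsq p.1 <= 1 - p.2 ^+ 2] `&` (snd @^-1` B).
have mA : measurable A.
  apply: measurableI; last exact: (measurable_preimageT measurable_snd mB).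
  apply: measurable_le; first exact: (measurableT_comp (@measurable_nsq R d)).
  by apply: measurable_funB => //; apply: measurable_funX; exact: measurable_snd.
pose h (p : d.-tuple (measurableTypeR R) * measurableTypeR R) : \bar R :=
  (Num.sqrt (nsq p.1) * q p.2 * \1_A p)%:E.
have mh : measurable_fun setT h.
  apply/measurable_EFinP; apply: measurable_funM; last exact: measurable_indic.
  apply: measurable_funM; last first.
    exact: (measurableT_comp (mq _) measurable_snd).
  apply: (@measurableT_comp _ _ _ _ _ _ (@Num.sqrt R)).
    by apply: continuous_measurable_fun; exact: sqrt_continuous.
  exact: (measurableT_comp (@measurable_nsq R d)).
have h0 p : (0 <= h p)%E by rewrite lee_fin !mulr_ge0 ?powR_ge0 ?sqrtr_ge0.
have AE w u : A (w, u) <-> D (Num.sqrt (nsq w)) u.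
  rewrite /A /D/= sqr_sqrtr ?nsq_ge0//; tauto.
transitivity (d.+1%:R%:E *
    \int[lebesgue_tuple d]_w \int[lebesgue_measure]_u h (w, u))%E.
  congr (_ * _)%E; apply: eq_integral => w _; apply: eq_integral => u _.
  by congr (_ * _)%:E; apply: eq_indic; rewrite AE.
(* From here on [u] is fixed, and the constraint on [w] describes a ball of radius
   [sqrt (1 - u^2)]. *)
rewrite (@fubini_tonelli _ _ _ _ _ (lebesgue_tuple d) lebesgue_measure h)//.
rewrite -ge0_integralZl//; last 2 first.
- by have := @measurable_fun_fubini_tonelli_G _ _ _ _ _ (lebesgue_tuple d) _ mh; apply.
- by move=> u _; exact: integral_ge0.
apply: eq_integral => u _.
have [Bu|Bu] := pselect (B u); last first.
  rewrite (eq_integral (cst 0%E)) ?integral0 ?mule0.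
    by rewrite indicE memNset// mulr0.
  by move=> w _; rewrite /h indicE memNset ?mulr0// => -[].
have q0 : 0 < 1 - u ^+ 2.
  by have := BI _ Bu; rewrite /= in_itv/= => /andP[u1 u2]; nra.
have sq0 : 0 < Num.sqrt (1 - u ^+ 2) by rewrite sqrtr_gt0.
have mrad : measurable_fun [set: d.-tuple (measurableTypeR R)] (fun w =>
    Num.sqrt (nsq w) * \1_(cball d (Num.sqrt (1 - u ^+ 2) ^+ 2)) w).
  apply: measurable_funM; last by apply: measurable_indic; exact: measurable_cball.
  apply: (@measurableT_comp _ _ _ _ _ _ (@Num.sqrt R)).
    by apply: continuous_measurable_fun; exact: sqrt_continuous.
  exact: measurable_nsq.
transitivity (d.+1%:R%:E * ((q u)%:E * \int[lebesgue_tuple d]_w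
  (Num.sqrt (nsq w) * \1_(cball d (Num.sqrt (1 - u ^+ 2) ^+ 2)) w)%:E))%E.
  congr (_ * _)%E; rewrite -ge0_integralZl//; last 2 first.
  - exact/measurable_EFinP.
  - by rewrite lee_fin powR_ge0.
  apply: eq_integral => w _; rewrite /h -EFinM; congr EFin.
  rewrite /= mulrCA mulrA; congr (_ * _); apply: eq_indic.
  rewrite /A /cball/= sqr_sqrtr ?(ltW q0)//; tauto.
rewrite (radial_moment d0 sq0 cE) -!EFinM; congr EFin.
rewrite indicE mem_set// mulr1.
have -> : Num.sqrt (1 - u ^+ 2) ^+ d.+1 = (1 - u ^+ 2) `^ (d.+1%:R / 2).
  rewrite -powR12_sqrt ?(ltW q0)//.
  rewrite -(powR_mulrn d.+1 (powR_ge0 (1 - u ^+ 2) 2^-1)) -powRrM.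
  by rewrite mulrC.
have -> : (d%:R - 2) / 2 = - (3 / 2) + d.+1%:R / 2 :> R.
  by rewrite -natr1; field.
rewrite powRD; last by apply/implyP => _; rewrite gt_eqF.
rewrite -/(q u); field.
by rewrite addrC natr1 pnatr_eq0.
Qed.

(** A normalized height outside []-1, 1[] forces [w = 0]. Integrating over [w] at fixed [t], every
    section of the cone thus lies in the null ball of radius 0. *)
Lemma sphere_area_poles (B : set R) : B `&` `]-1, 1[ = set0 ->
  measurable B -> sphere_area d (slice B) = 0%E.
Proof.
move=> BI mB; rewrite /sphere_area.
suff -> : lebesgue_tuple d.+1 (cone (slice B)) = 0%E by rewrite mule0.
have mS := measurable_cone_slice mB.
transitivity (\int[lebesgue_tuple d.+1]_v (\1_(cone (slice B)) v)%:E)%E.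
  by rewrite integral_indic// setIT.
rewrite integral_lebesgue_tupleS//; last first.
  by apply/measurable_EFinP; exact: measurable_indic.
rewrite (eq_integral (cst 0%E)) ?integral0// => t _ /=.
apply/eqP; rewrite eq_le integral_ge0// andbT.
apply: (@le_trans _ _ (\int[lebesgue_tuple d]_w (\1_(cball d (0 : R)) w)%:E)%E).
  apply: ge0_le_integral => //.
  - apply/measurable_EFinP.
    have mi : measurable_fun setT (\1_(cone (slice B)) : _ -> R).
      exact: measurable_indic.
    have mct : measurable_fun setT (@consT R d t).
      exact: (measurableT_comp (@measurable_consT R d) (measurable_pair1 t)).
    exact: (measurableT_comp mi mct).
  - apply/measurable_EFinP; apply: measurable_indic; exact: measurable_cball.
  - move=> w _; rewrite lee_fin !indicE.
    have [/set_mem/cone_slice|] := boolP (consT t w \in cone (slice B)) => //.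
    rewrite enorm_cons thead_cons => -[/andP[n0 n1] Bt].
    rewrite mem_set// /cball/= leNgt; apply/negP => w0.
    suff : set0 (t / Num.sqrt (t ^+ 2 + Num.sqrt (nsq w) ^+ 2)) by [].
    rewrite -BI; split => //=; rewrite in_itv/= -ltr_norml normrM normfV.
    rewrite (gtr0_norm n0) ltr_pdivrMr// mul1r -sqrtr_sqr ltr_sqrt.
      by rewrite ltrDl sqr_sqrtr// ltW.
    by rewrite ltr_wpDl ?sqr_ge0// sqr_sqrtr// ltW.
rewrite integral_indic ?setIT//; last exact: measurable_cball.
by rewrite (_ : _ (cball d (0 : R)) = 0%E)//; exact: ball_volume0 cE.
Qed.

End sphere_slice.

(** * Completed measures *)

Lemma integral_indic_mule d (T : measurableType d) (R : realType)
    (mu : {measure set T -> \bar R}) (D : set T) (f : T -> \bar R) :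
  (\int[mu]_(x in D) f x = \int[mu]_x ((\1_D x)%:E * f x))%E.
Proof.
rewrite integral_mkcond; apply: eq_integral => x _.
by rewrite patchE indicE; case: (x \in D); rewrite ?mul1e ?mul0e.
Qed.

Section completed_lebesgue.
Context (R : realType).
Notation cL := (@completed_lebesgue_measure R).
Notation cR := (caratheodory_type (wlength (@idfun R))^*%mu).

Lemma measurable_completed (A : set R) : measurable A ->
  measurable (A : set cR).
Proof. by move=> mA; exact: sub_caratheodory. Qed.

Lemma measurable_id_completed : measurable_fun (setT : set cR) (id : cR -> measurableTypeR R).
Proof. by move=> _ A mA; rewrite setTI; exact: measurable_completed. Qed.

(** Pushed forward by the identity to the Borel sigma-algebra, the completed measure is Lebesgue
    measure again. *)
Lemma ge0_integral_completed (D : set R) (g : R -> \bar R) : measurable D ->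
  measurable_fun setT g -> (forall x, 0 <= g x)%E ->
  (\int[cL]_(x in D) g x = \int[lebesgue_measure]_(x in D) g x)%E.
Proof.
move=> mD mg g0.
transitivity (\int[pushforward cL (id : cR -> measurableTypeR R)]_(x in D) g x)%E.
  apply/esym; apply: (ge0_integral_pushforward measurable_id_completed).
  - exact: mD.
  - exact: measurable_funTS.
  - by move=> x _; exact: g0.
unshelve eapply eq_measure_integral; first exact: measurable_id_completed.
by move=> A mA _; reflexivity.
Qed.

Lemma completed_measurableP (A : set R) : measurable (A : set cR) ->
  exists B N : set R, [/\ measurable B, measurable N, lebesgue_measure N = 0%E,
    B `<=` A & A `\` N = B `\` N].
Proof.
rewrite -completed_caratheodory_measurable g_sigma_completed_algebra_genE.
move=> [B mB [M [N [mN N0 MN]]] <-]; exists B, N; split => //.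
apply/seteqP; split => x [].
  by move=> [//|/MN].
by move=> Bx nNx; split => //; left.
Qed.

(** Each set [f > q] with [q] rational is Borel off a Borel null set. The union of these countably
    many null sets works for every real level [a], since [f > a] is the union of the sets [f > q]
    over rationals [q >= a]. *)
Lemma completed_measurable_fun (D : set R) (f : R -> R) : measurable D ->
  measurable_fun (D : set cR) f ->
  exists N, [/\ measurable N, lebesgue_measure N = 0%E &
    measurable_fun (D `\` N) f].
Proof.
move=> mD mf.
have H (q : rat) : exists BN : set R * set R, [/\ measurable BN.1, measurable BN.2,
    lebesgue_measure BN.2 = 0%E &
    (D `&` f @^-1` `]ratr q, +oo[) `\` BN.2 = BN.1 `\` BN.2].
  have [|B [N [mB mN N0 _ E]]] := @completed_measurableP (D `&` f @^-1` `]ratr q, +oo[).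
    by apply: mf => //; exact: measurable_completed.
  by exists (B, N).
have [BN HBN] := choice H.
pose F n := if unpickle n is Some q then (BN q).2 else set0.
have FB q : (BN q).2 `<=` \bigcup_n F n.
  move=> x Bx; exists (pickle q); first exact: Logic.I.
  rewrite /F pickleK; exact: Bx.
have mF n : measurable (F n).
  by rewrite /F; case: unpickle => // q; have [] := HBN q.
have mN : measurable (\bigcup_n F n) by exact: bigcupT_measurable.
exists (\bigcup_n F n); split => //.
  apply/negligibleP => //; apply: negligible_bigcup => n.
  apply/negligibleP; first exact: mF.
  rewrite /F; case: unpickle => [q|]; last exact: measure0.
  by have [] := HBN q.
move=> mDN; apply: (measurability _ (RGenOInfty.measurableE R)) => //.
move=> _ [_ [a ->] <-].
rewrite (_ : _ `&` _ = \bigcup_(q : rat)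
    (if a <= ratr q then (BN q).1 `\` \bigcup_n F n else set0)).
  apply: bigcupT_measurable_rat => q; case: ifPn => // _.
  by apply: measurableD => //; have [] := HBN q.
apply/seteqP; split => x.
  move=> [[Dx Nx]]; rewrite /= in_itv/= andbT => ax.
  have [q] := rat_in_itvoo ax; rewrite in_itv/= => /andP[aq qx].
  exists q => //; rewrite (ltW aq); split => //.
  have [_ _ _ E] := HBN q.
  suff : ((BN q).1 `\` (BN q).2) x by case.
  rewrite -E; split; last by move/FB.
  by split => //=; rewrite in_itv/= qx.
move=> [q _]; case: ifPn => // aq [Bx Nx].
have [_ _ _ E] := HBN q.
have : ((BN q).1 `\` (BN q).2) x by split => // /FB.
rewrite -E => -[[Dx]]; rewrite /= in_itv/= andbT => qx _.
by split => //=; rewrite in_itv/= andbT (le_lt_trans aq qx).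
Qed.

End completed_lebesgue.

(** * Distribution of the height on the sphere *)

Section sphere_integral.
Context (R : realType) (d : nat) (c x : R).
Hypotheses (d0 : (0 < d)%N) (cE : unit_ball_volume R d = c%:E) (x0 : 0 < x).
Local Notation T := (d.+1.-tuple (measurableTypeR R)).
Notation mu := (@sphere_area R d).
Notation cmu := (@completed_sphere_area R d).
Notation cT := (caratheodory_type (mu^*)%mu).
Let height (v : cT) : measurableTypeR R := x * thead (v : T) + x.

Lemma measurable_id_sphere : measurable_fun (setT : set cT) (id : cT -> T).
Proof.
move=> _ A mA; rewrite setTI; exact: caratheodory_measurable_mu_ext.
Qed.

Lemma measurable_height : measurable_fun (setT : set cT) height.
Proof.
have m1 : measurable_fun [set: T] (fun v => x * thead v + x).
  by apply: measurable_funD => //; apply: measurable_funM => //; exact: measurable_thead.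
exact: (measurableT_comp m1 measurable_id_sphere).
Qed.

Lemma measurable_slice (B : set R) : measurable B -> measurable (slice B : set T).
Proof.
move=> mB; rewrite (_ : slice B = sphere d `&` (fun v => thead v) @^-1` B)//.
apply: measurableI; first exact: measurable_sphere.
exact: (measurable_preimageT (@measurable_thead R d)).
Qed.

Let W (u : R) : R :=
  d%:R * c * (1 - u ^+ 2) `^ ((d%:R - 2) / 2) * \1_(`]-1, 1[%classic : set R) u.

Let mW : measurable_fun setT W.
Proof.
apply: measurable_funM; last exact: measurable_indic.
apply: measurable_funM => //.
apply: (measurableT_comp (@measurable_powR R _)).
by apply: measurable_funB => //; exact: measurable_funX.
Qed.

Let c0 : 0 <= c. Proof. by rewrite -lee_fin -cE; exact: measure_ge0. Qed.

Let W0 u : 0 <= W u.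
Proof. by rewrite !mulr_ge0 ?powR_ge0. Qed.

Let mS : measurable (sphere d : set cT).
Proof. by apply: caratheodory_measurable_mu_ext; exact: measurable_sphere. Qed.

Let integral_height_indic (A : set R) : measurable A ->
  (\int[cmu]_v ((\1_(sphere d) v)%:E * (\1_A (height v))%:E) =
   \int[lebesgue_measure]_u ((W u)%:E * (\1_A (x * u + x)%R)%:E))%E.
Proof.
move=> mA; pose B : set R := (fun u => x * u + x) @^-1` A.
have mB : measurable B.
  apply: measurable_preimageT => //.
  by apply: measurable_funD => //; exact: measurable_funM.
have mI : measurable (`]-1, 1[%classic : set R) by exact: measurable_itv.
transitivity (cmu (slice B)).
  transitivity (\int[cmu]_v (\1_(slice B) v)%:E)%E.
    apply: eq_integral => v _; rewrite -EFinM; congr EFin.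
    transitivity (\1_(sphere d `&` height @^-1` A) v : R); first by rewrite indicI.
    exact: eq_indic.
  rewrite integral_indic ?setIT//.
  by apply: caratheodory_measurable_mu_ext; exact: measurable_slice.
transitivity (mu (slice B)).
  by apply: measurable_mu_extE; exact: measurable_slice.
pose I : set R := `]-1, 1[%classic.
(* The density formula covers heights in []-1, 1[]; the remaining part of the slice sits at the
   poles and is null. *)
have -> : mu (slice B) = (mu (slice (B `&` I)) + mu (slice (B `\` I)))%E.
  have -> : slice B = slice (B `&` I) `|` slice (B `\` I) :> set T.
    apply/seteqP; split => v; rewrite /slice/=.
      by move=> [v1 Bv]; have [h|h] := pselect (I (thead v)); [left|right].
    by move=> [[-> []]|[-> []]].
  apply: measureU.
  - by apply: measurable_slice; exact: measurableI.
  - by apply: measurable_slice; exact: measurableD.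
  - by apply/seteqP; split => v // -[[_ [_ h]] [_ [_]]].
rewrite (@sphere_area_poles R d c d0 cE (B `\` I)); last 2 first.
- by apply/seteqP; split => v // -[[_ h]].
- exact: measurableD.
rewrite adde0 (sphere_area_slice d0 cE); last 2 first.
- exact: measurableI.
- by move=> v [].
apply: eq_integral => u _; rewrite -EFinM; congr EFin.
by rewrite indicI /W -!mulrA; congr (_ * (_ * (_ * _))); rewrite mulrC.
Qed.

Lemma integral_sphere_height (v : R -> R) : measurable_fun setT v ->
  (forall s, 0 <= v s) ->
  (\int[cmu]_(theta in sphere d) (v (height theta))%:E =
   (d%:R * c * x `^ (1 - d%:R))%:E *
   \int[lebesgue_measure]_(s in `]0%R, (2 * x)%R[)
     ((2 * x - s) `^ ((d%:R - 2) / 2) * s `^ ((d%:R - 2) / 2) * v s)%:E)%E.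
Proof.
move=> mv v0; rewrite integral_indic_mule.
transitivity (\int[lebesgue_measure]_u ((W u)%:E * (v (x * u + x))%:E))%E.
  apply: (@ge0_integral_transfer _ _ _ (measurableTypeR R) _ _ R cmu lebesgue_measure
    height (fun u => x * u + x) \1_(sphere d) W _ _ _ _ _ _ _ (EFin \o v)) => //.
  - exact: measurable_height.
  - by apply: measurable_funD => //; exact: measurable_funM.
  - exact/measurable_EFinP.
(* The integrand in the variable [s = x u + x], that is [u = s / x - 1], ready for
   [ge0_integral_affine]. *)
pose G (s : R) : \bar R := (W (x^-1 * s - 1) * v s)%:E.
transitivity (\int[lebesgue_measure]_u G (x * u + x)%R)%E.
  apply: eq_integral => u _; rewrite /G -EFinM.
  by have -> : x^-1 * (x * u + x) - 1 = u by field; rewrite gt_eqF.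
have mG : measurable_fun setT G.
  apply/measurable_EFinP; apply: measurable_funM => //.
  apply: (measurableT_comp mW).
  by apply: measurable_funB => //; exact: measurable_funM.
have G0 s : (0 <= G s)%E by rewrite lee_fin mulr_ge0.
rewrite ge0_integral_affine// -ge0_integralZl//; last by rewrite lee_fin invr_ge0 ltW.
have xd0 : 0 <= d%:R * c * x `^ (1 - d%:R) by rewrite !mulr_ge0 ?powR_ge0.
rewrite -ge0_integralZl//; last 2 first.
- apply/measurable_EFinP; apply: measurable_funTS; apply: measurable_funM => //.
  apply: measurable_funM; last exact: measurable_powR.
  apply: (measurableT_comp (@measurable_powR R _)).
  by apply: measurable_funB.
- by move=> s _; rewrite lee_fin !mulr_ge0 ?powR_ge0.
under [RHS]eq_integral do rewrite -EFinM.
rewrite [RHS]integral_mul_indic; apply: eq_integral => s _.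
rewrite /G -EFinM; congr EFin; rewrite /W.
have -> : \1_(`]-1, 1[%classic : set R) (x^-1 * s - 1) =
    \1_(`]0, (2 * x)[%classic : set R) s :> R.
  apply: eq_indic; rewrite /= !in_itv/= ltrBrDr addrC subrr ltrBlDr.
  by rewrite (pmulr_rgt0 _ (_ : 0 < x^-1)) ?invr_gt0// ltr_pdivrMl// mulrC.
rewrite [\1_(`]0, _[%classic : set R) s]indicE.
have [/set_mem|_] := boolP (s \in _); last by rewrite !(mulr0, mul0r).
rewrite /= in_itv/= => /andP[s0 sx]; rewrite !mulr1.
have -> : 1 - (x^-1 * s - 1) ^+ 2 = (2 * x - s) * s * x `^ (- 2).
  rewrite powRN -[2]/(2%:R) powR_mulrn ?ltW//; field.
  by rewrite gt_eqF.
rewrite !powRM ?mulr_ge0 ?powR_ge0 ?(ltW s0) ?subr_ge0 ?(ltW sx)//.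
rewrite -powRrM -(powR_inv1 (ltW x0)).
(* The exponent of [x]: -1 comes from the jacobian of the affine substitution, the rest from the
   factor [x^(-2)] in [1 - u^2], raised to the power [(d - 2)/2]. *)
have -> : 1 - d%:R = - 1 + - 2 * ((d%:R - 2) / 2) :> R by field.
rewrite powRD; last by apply/implyP => _; rewrite gt_eqF.
by ring.
Qed.

End sphere_integral.

(** Applied twice in the theorem: on the line, to replace [f0] by a Borel function, and on the
    sphere, to return to the original integrand. *)
Lemma integrable_ae_eq d (T : measurableType d) (R : realType)
    (mu : {measure set T -> \bar R}) (D : set T) (f g : T -> \bar R) :
  measurable D -> measurable_fun D g -> ae_eq mu D f g ->
  mu.-integrable D f ->
  mu.-integrable D g /\ (\int[mu]_(x in D) f x = \int[mu]_(x in D) g x)%E.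
Proof.
move=> mD mg fg /integrableP[mf fi]; split; last exact: ae_eq_integral.
apply/integrableP; split => //; apply: le_lt_trans fi.
rewrite le_eqVlt; apply/orP; left; apply/eqP; apply: ge0_ae_eq_integral => //.
- exact: measurableT_comp.
- exact: measurableT_comp.
- apply: filterS fg => x H Dx; by rewrite H.
Qed.

(** * Integrands of arbitrary sign *)

Section signed_sphere_integral.
Context (R : realType) (d : nat) (c r : R).
Hypotheses (d0 : (0 < d)%N) (cE : unit_ball_volume R d = c%:E) (r0 : 0 < r).
Notation cmu := (@completed_sphere_area R d).
Notation cL := (@completed_lebesgue_measure R).
Notation cT := (caratheodory_type (@sphere_area R d)^*%mu).
Let height (v : cT) : R := r * thead (v : d.+1.-tuple (measurableTypeR R)) + r.
Let K : R := d%:R * c * r `^ (1 - d%:R).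
Let D : set R := `]0, 2 * r[%classic.

(** The kernel of [F] at [t = 2 r] times the power of [s] contained in [f1]; multiplied by [f0 s] it
    is [F_integrand]. *)
Definition abel_weight (s : R) : R :=
  (2 * r - s) `^ ((d%:R - 2) / 2) * s `^ ((d%:R - 2) / 2).

Lemma abel_weight_ge0 s : 0 <= abel_weight s.
Proof. by rewrite mulr_ge0 ?powR_ge0. Qed.

Lemma measurable_abel_weight : measurable_fun setT abel_weight.
Proof.
apply: measurable_funM; last exact: measurable_powR.
by apply: (measurableT_comp (@measurable_powR R _)); exact: measurable_funB.
Qed.

Let K0 : 0 <= K.
Proof.
by rewrite !mulr_ge0 ?powR_ge0// -lee_fin -cE; exact: measure_ge0.
Qed.

Let ge0_integral_height (v : R -> R) : measurable_fun setT v ->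
  (forall s, 0 <= v s) ->
  (\int[cmu]_(theta in sphere d) (v (height theta))%:E =
   K%:E * \int[cL]_(s in D) (abel_weight s * v s)%:E)%E.
Proof.
move=> mv v0; rewrite (integral_sphere_height d0 cE r0)//.
rewrite ge0_integral_completed//.
- exact: measurable_itv.
- apply/measurable_EFinP; apply: measurable_funM => //.
  exact: measurable_abel_weight.
- by move=> s; rewrite lee_fin mulr_ge0// abel_weight_ge0.
Qed.

(** The nonnegative formula for the absolute value of [v] gives integrability; for the positive and
    negative parts it gives the equality, the nonnegative weight commuting with both parts. *)
Lemma integrable_sphere_height (v : R -> R) : measurable_fun setT v ->
  cL.-integrable D (fun s => (abel_weight s * v s)%:E) ->
  cmu.-integrable (sphere d) (fun theta => (v (height theta))%:E) /\
  (\int[cmu]_(theta in sphere d) (v (height theta))%:E =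
   K%:E * \int[cL]_(s in D) (abel_weight s * v s)%:E)%E.
Proof.
move=> mv iv.
have mvh : measurable_fun (setT : set cT) (fun theta => (v (height theta))%:E).
  apply/measurable_EFinP; apply: (measurableT_comp mv).
  exact: (@measurable_height R d r).
split.
  apply/integrableP; split; first exact: measurable_funTS.
  have -> : (\int[cmu]_(theta in sphere d) `|(v (height theta))%:E| =
      K%:E * \int[cL]_(s in D) `|(abel_weight s * v s)%:E|)%E.
    transitivity (\int[cmu]_(theta in sphere d) (`|v (height theta)|)%:E)%E => //.
    rewrite (@ge0_integral_height (fun s => `|v s|))//; last first.
      exact: measurableT_comp.
    congr (_ * _)%E; apply: eq_integral => s _; congr EFin.
    by rewrite normrM (ger0_norm (abel_weight_ge0 s)).
  rewrite lte_mul_pinfty ?lee_fin//.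
  by have /integrableP[] := iv.
pose vp s := Num.max (v s) 0; pose vn s := Num.max (- v s) 0.
have mvp : measurable_fun setT vp by exact: measurable_maxr.
have mvn : measurable_fun setT vn.
  by apply: measurable_maxr => //; exact: measurableT_comp.
have vp0 s : 0 <= vp s by rewrite le_max lexx orbT.
have vn0 s : 0 <= vn s by rewrite le_max lexx orbT.
rewrite [LHS]integralE [X in (_ * X)%E]integralE.
have -> : (\int[cmu]_(theta in sphere d)
    (fun theta => (v (height theta))%:E)^\+ theta =
    K%:E * \int[cL]_(s in D) (fun s => (abel_weight s * v s)%:E)^\+ s)%E.
  transitivity (\int[cmu]_(theta in sphere d) (vp (height theta))%:E)%E.
    by apply: eq_integral => theta _; rewrite funeposE /vp EFin_max.
  rewrite ge0_integral_height//; congr (_ * _)%E; apply: eq_integral => s _.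
  by rewrite funeposE /vp maxr_pMr ?abel_weight_ge0// mulr0 EFin_max.
have -> : (\int[cmu]_(theta in sphere d)
    (fun theta => (v (height theta))%:E)^\- theta =
    K%:E * \int[cL]_(s in D) (fun s => (abel_weight s * v s)%:E)^\- s)%E.
  transitivity (\int[cmu]_(theta in sphere d) (vn (height theta))%:E)%E.
    by apply: eq_integral => theta _; rewrite funenegE /vn EFin_max EFinN.
  rewrite ge0_integral_height//; congr (_ * _)%E; apply: eq_integral => s _.
  by rewrite funenegE /vn maxr_pMr ?abel_weight_ge0// mulr0 EFin_max mulrN EFinN.
have mD := measurable_completed (measurable_itv `]0, 2 * r[ : measurable D).
(* A finite positive part makes the difference meaningful in the extended reals, so that [K]
   distributes over it. *)
have fp := integrable_fin_num mD (integrable_funepos mD iv).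
apply/esym/muleBr; first by [].
exact: (fin_num_adde_defr _ fp).
Qed.

End signed_sphere_integral.

(** * From the mean over the sphere to the fractional integral *)

Lemma last_coord_vertical (R : realType) (m k : nat) (x : 'rV[R]_(m + 1))
    (xi : {vspace 'rV[R]_m}) (theta : k.+1.-tuple R) :
  last_coord (x + last_coord x *: vertical xi theta) =
  last_coord x * thead theta + last_coord x.
Proof.
by rewrite /last_coord linearD linearZ/= row_mxKr !mxE addrC.
Qed.

(** Here [m] is n - 1. Integrability on the sphere is part of the conclusion, so that [J] is not a
    default value of the integral. *)
Theorem lemma7p1 (R : realType) (m k : nat) (hk : (1 <= k <= m)%N)
    (f : 'rV[R]_(m + 1) -> R) (f0 : R -> R)
    (hf : forall y : 'rV[R]_(m + 1), halfspace y -> f y = f0 (last_coord y)) :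
  forall (x : 'rV[R]_(m + 1)) (xi : {vspace 'rV[R]_m}),
    halfspace x -> \dim xi = k ->
    completed_lebesgue_measure.-integrable
      `]0, 2 * last_coord x[ (EFin \o F_integrand k f0 (2 * last_coord x)) ->
    (completed_sphere_area k).-integrable
      (sphere k) (EFin \o J_integrand k f x xi) /\
    J k f x xi = Phi k f0 (last_coord x).
Proof.
move=> x xi r0 _ inth; have /andP[k0 _] := hk.
rewrite /halfspace/= in r0.
have [c [cE c0 Gk0 cG]] := ball_volume_Gamma R k0.
pose r := last_coord x; rewrite -/r in r0 inth *.
pose D : set R := `]0, 2 * r[%classic.
have mD : measurable D by exact: measurable_itv.
pose h := F_integrand k f0 (2 * r).
pose p : R := (k%:R - 2) / 2.
pose w := @abel_weight R k r.
have hE s : h s = w s * f0 s.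
  by rewrite /h /F_integrand /f1 /w /abel_weight -/p mulrCA mulrC mulrAC.
have mh : measurable_fun (D : set (caratheodory_type (wlength (@idfun R))^*%mu)) h.
  by have /integrableP[/measurable_EFinP] := inth.
have [N [mN N0 mhN]] := completed_measurable_fun mD mh.
pose E := D `\` N.
have mE : measurable E by exact: measurableD.
(* The weight is positive on [D], so [f0] is recovered from the integrand [h] and inherits its Borel
   measurability off [N]. *)
have wE s : D s -> f0 s = h s * ((2 * r - s) `^ (- p) * s `^ (- p)).
  rewrite /D/= in_itv/= => /andP[s0 sr]; rewrite hE /w /abel_weight -/p.
  rewrite !powRN; field.
  by rewrite !gt_eqF// powR_gt0// subr_gt0.
have mf0 : measurable_fun E f0.
  apply: (eq_measurable_fun (fun s => h s * ((2 * r - s) `^ (- p) * s `^ (- p)))).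
    by move=> s /set_mem[Ds _]; rewrite wE.
  apply: measurable_funM => //; apply: measurable_funTS.
  apply: measurable_funM; last exact: measurable_powR.
  by apply: (measurableT_comp (@measurable_powR R _)); exact: measurable_funB.
(* Equal to [f0] on [E] and 0 elsewhere: a Borel function on the whole line, as
   [integrable_sphere_height] requires. *)
pose G : R -> R := f0 \_ E.
have mG : measurable_fun setT G := iffLR (measurable_restrictT f0 mE) mf0.
have GE s : E s -> G s = f0 s by move=> Es; rewrite /G patchE mem_set.
have cLmD := measurable_completed mD.
have [iwG EwG] : completed_lebesgue_measure.-integrable D (fun s => (w s * G s)%:E) /\
    (\int[completed_lebesgue_measure]_(s in D) (h s)%:E =
     \int[completed_lebesgue_measure]_(s in D) (w s * G s)%:E)%E.
  apply: integrable_ae_eq cLmD _ _ inth.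
  - apply/measurable_EFinP; apply: measurable_funTS.
    have mwG : measurable_fun setT (fun s => w s * G s).
      by apply: measurable_funM => //; exact: measurable_abel_weight.
    exact: (measurableT_comp mwG (@measurable_id_completed R)).
  - exists N; split => //; first exact: measurable_completed.
    move=> s /= /not_implyP[Ds]; apply: contra_notP => Ns.
    by rewrite GE// -hE.
have [iG EG] := integrable_sphere_height k0 cE r0 mG iwG.
pose height (theta : caratheodory_type (@sphere_area R k)^*%mu) : R :=
  r * thead (theta : k.+1.-tuple (measurableTypeR R)) + r.
have mS : measurable (sphere k : set (caratheodory_type (@sphere_area R k)^*%mu)).
  by apply: caratheodory_measurable_mu_ext; exact: measurable_sphere.
have mCE : measurable (~` E) by exact: measurableC.
have mh1 := @measurable_height R k r.
(* The exceptional points of the sphere: their height lies in [N], or is 0 or [2 r] at the poles.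
   Elsewhere [G] and [f0] agree at the height. *)
pose X : set (caratheodory_type (@sphere_area R k)^*%mu) :=
  sphere k `&` height @^-1` (~` E).
have mX : measurable X.
  by apply: measurableI => //; apply: (measurable_preimageT mh1).
have X0 : completed_sphere_area k X = 0%E.
  transitivity (\int[completed_sphere_area k]_(theta in sphere k)
      (\1_(~` E) (height theta))%:E)%E.
    rewrite integral_mul_indic.
    transitivity (\int[completed_sphere_area k]_theta (\1_X theta)%:E)%E.
      by rewrite integral_indic ?setIT.
    apply: eq_integral => theta _; congr EFin.
    transitivity (\1_(height @^-1` (~` E) `&` sphere k) theta : R).
      by rewrite /X setIC.
    by rewrite indicI.
  have mI : measurable_fun setT (\1_(~` E) : R -> R) by exact: measurable_indic.
  (* The area of [X] becomes a weighted integral over [D] of the indicator of the complement of [E],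
     which vanishes off the null set [N]. *)
  rewrite (integral_sphere_height k0 cE r0 mI)//.
  rewrite (ge0_negligible_integral mN)//.
  - rewrite (eq_integral (cst 0%E)) ?integral0 ?mule0// => s /set_mem Es.
    by rewrite indicE memNset ?mulr0//; apply.
  - apply/measurable_EFinP; apply: measurable_funTS; apply: measurable_funM => //.
    exact: measurable_abel_weight.
  - by move=> s _; rewrite lee_fin mulr_ge0// abel_weight_ge0.
have heightE theta : height theta = last_coord (x + r *: vertical xi theta).
  by rewrite last_coord_vertical.
have aeJ : ae_eq (completed_sphere_area k) (sphere k)
    (fun theta => (G (height theta))%:E) (EFin \o J_integrand k f x xi).
  exists X; split => // theta /= /not_implyP[Stheta]; apply: contra_notP => nX.
  have Eh : E (height theta) by apply: contrapT => nE; apply: nX; split.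
  rewrite GE// /J_integrand -/r hf -?heightE//.
  have [+ _] := Eh; rewrite /D /halfspace/= -heightE in_itv/=.
  by move=> /andP[].
(* By completeness of the surface measure, a function almost everywhere equal to a measurable one is
   measurable. *)
have mJ : measurable_fun (sphere k : set (caratheodory_type (@sphere_area R k)^*%mu))
    (EFin \o J_integrand k f x xi).
  apply: (@ae_measurable_fun _ _ _ (completed_sphere_area k)
    (@measure_is_complete_caratheodory _ _ _) _ _ _ aeJ).
  by have /integrableP[] := iG.
have [iJ EJ] := integrable_ae_eq mS mJ aeJ iG.
split => //; rewrite /J /Phi /F /Rintegral.
have -> : (\int[completed_sphere_area k]_(theta in sphere k)
    (J_integrand k f x xi theta)%:E =
    (k%:R * c * r `^ (1 - k%:R))%:E *
      \int[completed_lebesgue_measure]_(s in `]0%R, (2 * r)%R[) (h s)%:E)%E.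
  by rewrite EwG -EG EJ.
have fin : (\int[completed_lebesgue_measure]_(s in `]0%R, (2 * r)%R[) (h s)%:E)%E
    \is a fin_num by exact: integrable_fin_num.
rewrite -/h -(fineK fin) -EFinM/=; set I := fine _.
have sp : 0 < Num.sqrt pi :> R by rewrite sqrtr_gt0 pi_gt0.
rewrite /sigma_ invf_div.
have -> : pi `^ (k.+1%:R / 2) = Num.sqrt pi ^+ k * Num.sqrt pi :> R.
  rewrite -exprSr -powR12_sqrt ?pi_ge0//.
  by rewrite -(powR_mulrn k.+1 (powR_ge0 pi 2^-1)) -powRrM mulrC.
have -> : pi `^ (1 / 2) = Num.sqrt pi :> R by rewrite mul1r powR12_sqrt ?pi_ge0.
(* By [cG], [k c] is 2 [sqrt pi]^k / [Gamma (k / 2)]; divided by [sigma_ k] it gives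
   [Gamma ((k + 1) / 2)] over [sqrt pi] times [Gamma (k / 2)], the constants of [Phi] and [F]. *)
rewrite -cG; field.
by rewrite !gt_eqF//= ltr0n.
Qed.
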